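(* Let $d\ge1$ be an integer, let $1<p<+\infty$, let $c>0$, let $A\in\mathbb{R}^{d\times d}$ be a symmetric positive semi-definite matrix, and let $a\in\mathbb{R}$. Let $\Omega=\,]0,+\infty[$ if $d=1$ and $\Omega=\mathbb{R}^d$ if $d\ge 2$, and let $\mu$ be the Borel measure $d\mu=\rho(x)\,dx$ with density $\rho(x)=c\exp\big(-\tfrac1p (x^{t}Ax)^{p/2}\big)$. Then $$\Big(\frac{|d-p(a+1)|}{p}\Big)^{p}\int_{\Omega}\frac{|u|^{p}}{|x|^{p(a+1)}}\,d\mu\le\int_{\Omega}\frac{|\nabla u|^{p}}{|x|^{pa}}\,d\mu+\Big(\frac{|d-p(a+1)|}{p}\Big)^{p-1}\operatorname{sgn}(d-p(a+1))\int_{\Omega}|u|^{p}\,\frac{(x^{t}Ax)^{p/2}}{|x|^{p(a+1)}}\,d\mu$$ for all $u\in C^{\infty}_{c,0}$. Moreover, if either $A=0$ or $A$ is positive definite, then the constant $\big(\tfrac{|d-p(a+1)|}{p}\big)^{p}$ is optimal (including the case $p(a+1)=d$); that is, for no $\lambda>\big(\tfrac{|d-p(a+1)|}{p}\big)^{p}$ does the inequality obtained by replacing the constant in front of the left-hand integral by $\lambda$ (leaving the right-hand side unchanged) hold for all $u\in C^{\infty}_{c,0}$.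
   Context: $C^{\infty}_{c,0}$ denotes $C_c^\infty(]0,+\infty[)$ if $d=1$ and $C_c^\infty(\mathbb{R}^d\setminus\{0\})$ if $d\ge2$ (infinitely differentiable functions with compact support in the indicated open set). $|x|$ is the Euclidean norm, $x^t$ the transpose of $x$, and $\operatorname{sgn}$ is the sign function with $\operatorname{sgn}(0)=0$. When $p(a+1)=d$ the last term on the right-hand side is read as $0$. *)

(* Defs.v *)
From HB Require Import structures.
From mathcomp Require Import all_boot all_order all_algebra.
From mathcomp Require Import all_classical all_reals all_analysis.
From mathcomp Require Import measurable_realfun ring lra.

Set Implicit Arguments.
Unset Strict Implicit.
Unset Printing Implicit Defensive.

Import Order.TTheory GRing.Theory Num.Theory.
Import numFieldNormedType.Exports.

Local Open Scope classical_set_scope.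
Local Open Scope ring_scope.

Definition borel_rV (R : realType) (d : nat) :=
  g_sigma_algebraType (open : set (set 'rV[R]_d)).

Section lebesgue_rV.
Context (R : realType).

Definition cons_rV d (z : measurableTypeR R * borel_rV R d) :
    borel_rV R d.+1 :=
  row_mx (const_mx z.1 : 'rV[R]_1) (z.2 : 'rV[R]_d).

Lemma open_borel_rV d (U : set 'rV[R]_d) :
  open U -> measurable (U : set (borel_rV R d)).
Proof. exact: sub_gen_smallest. Qed.

Lemma measurable_cons_rV d : measurable_fun [set: _] (@cons_rV d).
Proof.
apply: (@measurability _ _ (measurableTypeR R * borel_rV R d)%type
  (borel_rV R d.+1) _ _ (open : set (set 'rV[R]_d.+1))) => //.
move=> _ [U oU <-]; rewrite setTI.
pose box (i : rat * 'rV[rat]_d * rat) : set (measurableTypeR R * borel_rV R d) :=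
  (ball (ratr i.1.1 : R) (ratr i.2 : R)) `*`
  (ball (map_mx ratr i.1.2 : 'rV[R]_d) (ratr i.2 : R)).
pose F i :=
  if `[< 0 < ratr i.2 :> R /\ box i `<=` @cons_rV d @^-1` U >] then box i
  else set0.
rewrite (_ : _ @^-1` _ = \bigcup_i F i).
  apply: countable_bigcupT_measurable => // i; rewrite /F.
  case: asboolP => // -[r0 _].
  apply: measurableX; last by apply: open_borel_rV; exact: ball_open.
  by apply: open_measurable; exact: ball_open.
apply/seteqP; split=> [[x v] Uxv|z [i _]]; last first.
  by rewrite /F; case: asboolP => // -[_ iU]; exact: iU.
have /nbhs_ballP[e /= e0 eU] : nbhs (cons_rV (x, v) : 'rV[R]_d.+1) U.
  exact: open_nbhs_nbhs.
have [r /itvP rP] := rat_in_itvoo (divr_gt0 e0 (@ltr0n R 2)).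
have r0 : 0 < ratr r :> R by rewrite rP.
have dq (y : R) : {q : rat | `|ratr q - y| < ratr r}.
  apply/cid; have [q] : exists q : rat, ratr q \in `]y - ratr r, y + ratr r[.
    apply: rat_in_itvoo; lra.
  by rewrite in_itv /= -ltr_distl; exists q.
pose q0 := sval (dq x); pose q1 := \row_j sval (dq ((v : 'rV[R]_d) 0 j)).
exists (q0, q1, r) => //; rewrite /F ifT.
  split=> /=; first exact: (svalP (dq x)).
  split=> // i j; rewrite !mxE ord1; exact: (svalP (dq (v 0 j))).
apply/asboolP; split => // -[x' v'] /= [/= bx [_ bv]].
apply: eU; split=> // i j; rewrite /cons_rV ord1.
rewrite /ball/= !mxE; case: splitP => k _; rewrite ?mxE.
- have := svalP (dq x); rewrite -/q0 => hx; move: bx; rewrite /ball/= => bx.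
  have -> : x - x' = (ratr q0 - x') - (ratr q0 - x) by lra.
  apply: (le_lt_trans (ler_normB _ _)); rewrite (splitr e).
  by apply: ltrD; rewrite (lt_trans _ (_ : ratr r < _)) ?rP.
- have := svalP (dq (v 0 k)); move: (bv 0 k); rewrite /ball/= !mxE.
  set q := ratr _ => hv' hv.
  have -> : (v : 'rV_d) 0 k - (v' : 'rV_d) 0 k
    = (q - (v' : 'rV_d) 0 k) - (q - (v : 'rV_d) 0 k) by lra.
  apply: (le_lt_trans (ler_normB _ _)); rewrite (splitr e).
  by apply: ltrD; rewrite (lt_trans _ (_ : ratr r < _)) ?rP.
Qed.

Lemma continuous_measurable_rV d (f : 'rV[R]_d -> R) :
  continuous f -> measurable_fun setT (f : borel_rV R d -> R).
Proof.
move=> /continuousP cf.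
apply: (measurability _ (RGenOpens.measurableE R)).
move=> _ [_ [a [b ->] <-]]; rewrite setTI; apply: open_borel_rV.
exact/cf/interval_open.
Qed.

Lemma measurable_rsubmx_rV d : measurable_fun setT
  (fun x : borel_rV R d.+1 => rsubmx (x : 'rV[R]_(1 + d)) : borel_rV R d).
Proof.
apply: (@measurability _ _ (borel_rV R d.+1) (borel_rV R d) _ _
  (open : set (set 'rV[R]_d))) => //.
move=> _ [U oU <-]; rewrite setTI; apply: open_borel_rV.
move: U oU; apply/continuousP; exact: (@continuous_rsubmx R 1 1 d).
Qed.

Section lebesgue_cons.
Context (d : nat) (m : {sigma_finite_measure set (borel_rV R d) -> \bar R}).

Definition lebesgue_cons : set (borel_rV R d.+1) -> \bar R :=
  pushforward (lebesgue_measure \x m)%E (@cons_rV d).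

Let lebesgue_cons0 : lebesgue_cons set0 = 0%E.
Proof. by rewrite /lebesgue_cons /pushforward preimage_set0 measure0. Qed.

Let lebesgue_cons_ge0 A : (0 <= lebesgue_cons A)%E.
Proof. by rewrite /lebesgue_cons /pushforward measure_ge0. Qed.

Let lebesgue_cons_sigma_additive : semi_sigma_additive lebesgue_cons.
Proof.
move=> F mF tF mUF; rewrite /lebesgue_cons /pushforward preimage_bigcup.
have mcons := @measurable_cons_rV d.
apply: measure_semi_sigma_additive.
- by move=> n; rewrite -[X in measurable X]setTI; exact: mcons.
- apply/trivIsetP => /= i j _ _ ij; rewrite -preimage_setI.
  by move/trivIsetP : tF => /(_ _ _ _ _ ij) ->//; rewrite preimage_set0.
- by rewrite -preimage_bigcup -[X in measurable X]setTI; exact: mcons.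
Qed.

HB.instance Definition _ := isMeasure.Build _ _ _ lebesgue_cons
  lebesgue_cons0 lebesgue_cons_ge0 lebesgue_cons_sigma_additive.

Let lebesgue_cons_sigma_finite : sigma_finite setT lebesgue_cons.
Proof.
have /sigma_finiteP[F [TF ndF Foo]] := sigma_finiteT (@lebesgue_measure R).
have /sigma_finiteP[G [TG ndG Goo]] := sigma_finiteT m.
exists (fun n => [set x : borel_rV R d.+1 |
  F n ((x : 'rV[R]_d.+1) 0 0) /\ G n (rsubmx (x : 'rV[R]_(1 + d)))]).
  apply/esym/seteqP; split=> // x _.
  have : setT ((x : 'rV[R]_d.+1) 0 0) by [].
  rewrite TF => -[n _ Fn].
  have : setT (rsubmx (x : 'rV[R]_(1 + d))) by [].
  rewrite [X in X _]TG => -[k _ Gk]; exists (maxn n k) => //; split.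
    by move: Fn; exact/subsetPset/ndF/leq_maxl.
  by move: Gk; exact/subsetPset/ndG/leq_maxr.
move=> n; have [mF Fn] := Foo n; have [mG Gn] := Goo n; split.
  apply: measurableI.
    rewrite -[X in measurable X]setTI; apply: continuous_measurable_rV => //.
    exact: coord_continuous.
  by rewrite -[X in measurable X]setTI; exact: measurable_rsubmx_rV.
rewrite /lebesgue_cons /pushforward (_ : _ @^-1` _ = F n `*` G n).
  by rewrite product_measure1E// lte_mul_pinfty// ge0_fin_numE.
apply/seteqP; split=> -[x v] /=; rewrite /cons_rV row_mxKr;
  by rewrite mxE; case: splitP => // k _; rewrite mxE.
Qed.

HB.instance Definition _ := Measure_isSigmaFinite.Build _ _ _ lebesgue_cons
  lebesgue_cons_sigma_finite.

End lebesgue_cons.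

(* Lebesgue measure on R^d, as the d-fold product of the Lebesgue measure on R
   transported to row vectors by R * R^d ~ R^(d + 1). *)
Fixpoint lebesgue_rV d : {sigma_finite_measure set (borel_rV R d) -> \bar R} :=
  match d with
  | 0 => @dirac _ (borel_rV R 0) (0 : 'rV[R]_0) R
  | d'.+1 => lebesgue_cons (lebesgue_rV d')
  end.

End lebesgue_rV.

(* The norm `|x| of the library on 'rV[R]_d is the max norm. *)
Definition enorm (R : realType) d (x : 'rV[R]_d) : R :=
  Num.sqrt (\sum_i x 0 i ^+ 2).

Definition quad_form (R : realType) d (A : 'M[R]_d) (x : 'rV[R]_d) : R :=
  (x *m A *m x^T) 0 0.

Definition pos_semidef (R : realType) d (A : 'M[R]_d) :=
  forall x : 'rV[R]_d, 0 <= quad_form A x.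

Definition pos_def (R : realType) d (A : 'M[R]_d) :=
  forall x : 'rV[R]_d, x != 0 -> 0 < quad_form A x.

Definition rho (R : realType) d (p c : R) (A : 'M[R]_d) (x : 'rV[R]_d) : R :=
  c * expR (- (p^-1 * quad_form A x `^ (p / 2))).

(* The measure rho(x) dx on the whole of R^d; for d = 1 it is only used by
   integrating over Omega 1. The positivity of c is an argument so that the
   measure structure can be declared canonical. *)
Definition rho_measure (R : realType) d (p c : R) (A : 'M[R]_d) & 0 < c :
    set (borel_rV R d) -> \bar R :=
  fun V => (\int[lebesgue_rV R d]_(x in V) (rho p c A x)%:E)%E.

Section rho_measure.
Context (R : realType) (d : nat) (p c : R) (A : 'M[R]_d) (c0 : 0 < c).

Lemma rho_ge0 (x : 'rV[R]_d) : 0 <= rho p c A x.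
Proof. by rewrite mulr_ge0 ?expR_ge0// ltW. Qed.

Lemma measurable_rho :
  measurable_fun setT (rho p c A : borel_rV R d -> R).
Proof.
apply: measurable_funM => //; apply: measurableT_comp => //.
apply: measurableT_comp => //; apply: measurable_funM => //.
apply: (measurableT_comp (measurable_powR _)).
rewrite /quad_form; under eq_fun do rewrite mxE.
apply: measurable_sum => i; apply: measurable_funM.
  under eq_fun do rewrite mxE.
  apply: measurable_sum => j; apply: measurable_funM => //.
  by apply: continuous_measurable_rV; exact: coord_continuous.
under eq_fun do rewrite mxE.
by apply: continuous_measurable_rV; exact: coord_continuous.
Qed.

Local Notation mu := (rho_measure p A c0).

Let rho_measure0 : mu set0 = 0%E.
Proof. by rewrite /rho_measure integral_set0. Qed.

Let rho_measure_ge0 V : (0 <= mu V)%E.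
Proof. by apply: integral_ge0 => x _; rewrite lee_fin rho_ge0. Qed.

Let rho_measure_sigma_additive : semi_sigma_additive mu.
Proof.
move=> /= F mF tF mUF; rewrite /rho_measure; apply: cvg_toP.
  apply: ereal_nondecreasing_is_cvgn => i n le_in.
  apply: lee_sum_nneg_natr => // k _ _.
  by apply: integral_ge0 => /= x _; rewrite lee_fin rho_ge0.
rewrite ge0_integral_bigcup//=.
- apply: measurable_funTS; apply: measurableT_comp => //.
  exact: measurable_rho.
- by move=> x _; rewrite lee_fin rho_ge0.
Qed.

HB.instance Definition _ := isMeasure.Build _ _ _ mu
  rho_measure0 rho_measure_ge0 rho_measure_sigma_additive.

End rho_measure.

Section test_functions.
Context (R : realType) (d : nat).
Implicit Types (u : 'rV[R]_d -> R) (x : 'rV[R]_d).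

Definition partial (i : 'I_d) u x : R := 'D_(delta_mx 0 i) u x.

Definition gradient u x : 'rV[R]_d := \row_i partial i u x.

Definition smooth u := forall s : seq 'I_d,
  continuous (foldr partial u s) /\
  forall i x, derivable (foldr partial u s) x (delta_mx 0 i).

Definition support u : set 'rV[R]_d := closure [set x | u x != 0].

Definition Omega : set 'rV[R]_d :=
  if d == 1%N then [set x | forall i, 0 < x 0 i] else setT.

Definition Omega0 : set 'rV[R]_d :=
  if d == 1%N then [set x | forall i, 0 < x 0 i] else [set x | x != 0].

(* A function in C_c^oo(Omega0) is identified with its extension by zero to
   R^d, which is smooth on R^d. *)
Definition Cc_infty0 u :=
  [/\ smooth u, compact (support u) & support u `<=` Omega0].

End test_functions.

Arguments Omega : clear implicits.
Arguments Omega0 : clear implicits.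

(* For d = p (a + 1), the coefficient of the last integral is 0 `^ (p - 1) * 0,
   which is 0. *)
Definition hardy_inequality (R : realType) d (p c a : R) (A : 'M[R]_d)
    (c0 : 0 < c) (lam : R) (u : 'rV[R]_d -> R) : Prop :=
  let mu := rho_measure p A c0 in
  let k := d%:R - p * (a + 1) in
  (lam%:E * \int[mu]_(x in Omega R d)
      (`|u x| `^ p / enorm x `^ (p * (a + 1)))%:E
   <= \int[mu]_(x in Omega R d)
        (enorm (gradient u x) `^ p / enorm x `^ (p * a))%:E
      + ((`|k| / p) `^ (p - 1) * Num.sg k)%:E
        * \int[mu]_(x in Omega R d)
            (`|u x| `^ p * quad_form A x `^ (p / 2)
             / enorm x `^ (p * (a + 1)))%:E)%E.

(* Main.v *)
Require Import Defs.
From HB Require Import structures.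
From mathcomp Require Import all_boot all_order all_algebra.
From mathcomp Require Import all_classical all_reals all_analysis.
From mathcomp Require Import measurable_realfun ring lra zify.

Set Implicit Arguments.
Unset Strict Implicit.
Unset Printing Implicit Defensive.

Import Order.TTheory GRing.Theory Num.Theory.
Import numFieldNormedType.Exports.

Local Open Scope classical_set_scope.
Local Open Scope ring_scope.

(** Write s = p (a + 1), k = d - s, kap = |k| / p and
    sig = kap^(p-1) sgn k, and let rho be the density of the measure.

    The inequality.  The vector field x |x|^(-s) rho |u|^p has divergence
      D = (k |u|^p + p |u|^(p-1) sgn u (x . grad u) - (x^t A x)^(p/2) |u|^p)
            |x|^(-s) rho,
    because (x^t A x)^(p/2) is homogeneous of degree p.  Bounding the middle
    term by Young's inequality gives the pointwise estimate
    [hardy_pointwise]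
      kap^p |u|^p |x|^(-s) rho
        <= |grad u|^p |x|^(-pa) rho
           + sig (|u|^p (x^t A x)^(p/2) |x|^(-s) rho + D),
    and the integral of D vanishes.  Only derivatives along rays occur in D:
    with h = |u|^p |x|^(-s) rho, the function e^(d tau) D(e^tau x) is the
    derivative in tau of e^(d tau) h(e^tau x) [is_derive_dilation].  So the
    divergence theorem is replaced by the fundamental theorem of calculus for
    tau in [0, 1], followed by integration over x: by the scaling law of the
    Lebesgue measure, averaging e^(d tau) f(e^tau x) over [0, 1] does not
    change an integral [integral_dilation_average], and the two boundary terms
    have the same integral and cancel.  Along a ray x^t A x and |x| are
    monomials in e^tau, and all functions integrated over x are nonnegative.

    Optimality.  If u = |x|^(-k/p), then |u|^p |x|^(-s) = |x|^(-d) and |grad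
    u|^p |x|^(-pa) = kap^p |x|^(-d), also when k = 0. The measure |x|^(-d) dx
    is invariant under dilations, so every shell {t <= |x| < 2 t} has the same
    mass w [shell_massZ]. Multiply u by a radial cutoff chi that is 1 on n
    consecutive dyadic shells and goes down to 0 on one more shell at each
    end.  Then, up to terms independent of n, the left-hand integral is about
    c n w and the gradient integral about c kap^p n w, since |x| chi'(|x|) is
    bounded [cutoff'_le]. Supporting u in a small ball makes rho close to c
    and the last integral at most del c n w with del as small as desired, up
    to such terms.  Letting n grow excludes every lam > kap^p [hardy_optimal].

    The test functions must be smooth in the sense that all iterated partial
    derivatives exist and are continuous.  They are built inside two inductive
    classes of functions closed under differentiation, [smooth1] on the line
    and [smooth_rV] on the space of row vectors. *)

(** * Integration of nonnegative functions *)

Section density.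
Context dd (T : measurableType dd) (R : realType).
Variables (mu nu : {measure set T -> \bar R}) (g : T -> R).
Hypothesis g0 : forall x, 0 <= g x.
Hypothesis mg : measurable_fun setT g.
Hypothesis nuE : forall V, measurable V -> nu V = (\int[mu]_(x in V) (g x)%:E)%E.

Import HBNNSimple.
Local Open Scope ereal_scope.

(** By linearity from indicators to simple functions, then by monotone
    convergence. *)
Lemma ge0_integral_density (f : T -> \bar R) D : (forall x, 0 <= f x) ->
    measurable D -> measurable_fun D f ->
  \int[nu]_(x in D) f x = \int[mu]_(x in D) (f x * (g x)%:E).
Proof.
move=> f0 mD mf.
pose h := nnsfun_approx mD mf.
have mgE E : measurable_fun E (EFin \o g).
  exact/measurable_EFinP/measurable_funTS.
have -> : \int[nu]_(x in D) f x =
    lim (\int[nu]_(x in D) (EFin \o h n) x @[n --> \oo]).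
  have fE x : D x -> f x = lim ((EFin \o h n) x @[n --> \oo]).
    by move=> Dx; apply/esym/cvg_lim => //; exact: cvg_nnsfun_approx.
  under eq_integral => x /[!inE] /fE -> //.
  apply: monotone_convergence => //.
  - by move=> n; apply/measurable_EFinP/measurable_funTS.
  - by move=> n x Dx //=; rewrite lee_fin.
  - by move=> x Dx a b ab; rewrite lee_fin; exact/lefP/nd_nnsfun_approx.
have -> : \int[mu]_(x in D) (f x * (g x)%:E) =
    lim (\int[mu]_(x in D) ((EFin \o h n) x * (g x)%:E) @[n --> \oo]).
  have fg x : D x -> f x * (g x)%:E = lim ((EFin \o h n) x * (g x)%:E @[n --> \oo]).
    by move=> Dx; apply/esym/cvg_lim => //; apply: cvgeZr => //;
      exact: cvg_nnsfun_approx.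
  under eq_integral => x /[!inE] /fg -> //.
  apply: monotone_convergence => [//| | |].
  - by move=> n; apply: emeasurable_funM => //;
      apply/measurable_EFinP/measurable_funTS.
  - by move=> n x Dx /=; rewrite mule_ge0 ?lee_fin ?g0.
  - move=> x Dx a b ab/=; rewrite lee_wpmul2r ?lee_fin ?g0//.
    exact/lefP/nd_nnsfun_approx.
suff suf n : \int[mu]_(x in D) ((EFin \o h n) x * (g x)%:E) =
    \int[nu]_(x in D) (EFin \o h n) x.
  by congr (limn _); apply/funext => n; rewrite suf.
transitivity (\int[nu]_(x in D)
   (\sum_(y \in range (h n)) (y * \1_(h n @^-1` [set y]) x)%:E)); last first.
  by apply: eq_integral => t tD; rewrite /= fimfunE -fsumEFin.
have indich m r : measurable_fun D (fun x => (r * \1_(h m @^-1` [set r]) x)%:E).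
  by apply: (measurable_comp measurableT) => //; exact: measurable_funM.
rewrite ge0_integral_fsum//; last by move=> m y Dy; exact: nnfun_muleindic_ge0.
transitivity (\int[mu]_(x in D) (\sum_(y \in range (h n))
    (y * \1_(h n @^-1` [set y]) x)%:E * (g x)%:E)).
  under [RHS]eq_integral => x xD.
    rewrite -ge0_mule_fsuml => [|y]; last exact: nnfun_muleindic_ge0.
    rewrite fsumEFin // -(fimfunE _ x); over.
  by [].
rewrite ge0_integral_fsum//; last 2 first.
  - by move=> y; apply: emeasurable_funM.
  - by move=> m y Dy; rewrite mule_ge0 ?lee_fin ?g0// -lee_fin nnfun_muleindic_ge0.
apply: eq_fsbigr => r rhn.
under [RHS]eq_integral do rewrite EFinM.
rewrite integralZl_indic_nnsfun => //.
under eq_integral do rewrite EFinM -muleA.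
rewrite ge0_integralZl//.
- under eq_integral do rewrite muleC.
  rewrite (eq_integral ((EFin \o g) \_ (h n @^-1` [set r]))); last first.
    by move=> x xD; rewrite epatch_indic.
  rewrite -integral_mkcondr -nuE ?integral_indic//; by rewrite setIC.
- by apply: emeasurable_funM => //; exact/measurable_EFinP.
- by move=> t Dt; rewrite mule_ge0 ?lee_fin ?g0.
- by move: rhn; rewrite inE => -[t _ <-]; rewrite lee_fin.
Qed.

End density.

Section real_linearity.
Context dd (T : measurableType dd) (R : realType) (mu : {measure set T -> \bar R}).
Local Open Scope ereal_scope.

Lemma ge0_integralZlT (r : R) (f : T -> \bar R) : (0 <= r)%R ->
  measurable_fun setT f -> (forall x, 0 <= f x) ->
  \int[mu]_x (r%:E * f x) = r%:E * \int[mu]_x f x.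
Proof. by move=> r0 mf f0; rewrite ge0_integralZl. Qed.

Lemma ge0_integralZ_EFin (r : R) (f : T -> R) : (0 <= r)%R ->
  measurable_fun setT f -> (forall x, 0 <= f x)%R ->
  \int[mu]_x (r * f x)%:E = r%:E * \int[mu]_x (f x)%:E.
Proof.
move=> r0 mf f0; under eq_integral do rewrite EFinM.
rewrite ge0_integralZl//; first exact/measurable_EFinP.
by move=> x _; rewrite lee_fin.
Qed.

Lemma ge0_integral_lincomb (r s : R) (f g : T -> R) : (0 <= r)%R -> (0 <= s)%R ->
  measurable_fun setT f -> measurable_fun setT g ->
  (forall x, 0 <= f x)%R -> (forall x, 0 <= g x)%R ->
  \int[mu]_x (r * f x + s * g x)%:E =
  r%:E * \int[mu]_x (f x)%:E + s%:E * \int[mu]_x (g x)%:E.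
Proof.
move=> r0 s0 mf mg f0 g0; under eq_integral do rewrite EFinD.
rewrite ge0_integralD//; last 4 first.
- by move=> x _; rewrite lee_fin mulr_ge0.
- by apply/measurable_EFinP; exact: measurable_funM.
- by move=> x _; rewrite lee_fin mulr_ge0.
- by apply/measurable_EFinP; exact: measurable_funM.
by rewrite !ge0_integralZ_EFin.
Qed.

(** A pointwise inequality with boundary terms gives an integral inequality
    without them as soon as these terms have the same finite integral. *)
Lemma ge0_le_integral_cancel (f g h1 h2 : T -> \bar R) :
  measurable_fun setT f -> measurable_fun setT g ->
  measurable_fun setT h1 -> measurable_fun setT h2 ->
  (forall x, 0 <= f x) -> (forall x, 0 <= g x) ->
  (forall x, 0 <= h1 x) -> (forall x, 0 <= h2 x) ->
  (forall x, f x + h1 x <= g x + h2 x) ->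
  \int[mu]_x h1 x = \int[mu]_x h2 x -> \int[mu]_x h1 x < +oo ->
  \int[mu]_x f x <= \int[mu]_x g x.
Proof.
move=> mf mg mh1 mh2 f0 g0 h10 h20 fg hh hoo.
have hf : \int[mu]_x h1 x \is a fin_num by rewrite ge0_fin_numE// integral_ge0.
rewrite -(leeD2rE _ _ hf) {2}hh -!ge0_integralD//.
apply: ge0_le_integral => //.
- by move=> x _; rewrite adde_ge0.
- exact: emeasurable_funD.
- exact: emeasurable_funD.
Qed.

End real_linearity.

(** * Scaling of the Lebesgue measure *)

Section lebesgue_rV_theory.
Context (R : realType).
Local Open Scope ereal_scope.

Lemma ge0_integral_lebesgue_rVS d (f : borel_rV R d.+1 -> \bar R) :
  measurable_fun setT f -> (forall x, 0 <= f x) ->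
  \int[lebesgue_rV R d.+1]_x f x =
  \int[lebesgue_measure]_x \int[lebesgue_rV R d]_v f (cons_rV (x, v)).
Proof.
move=> mf f0.
transitivity (\int[pushforward (lebesgue_measure \x lebesgue_rV R d)
   (@cons_rV R d)]_x f x); first by [].
rewrite ge0_integral_pushforward//=; last exact: measurable_cons_rV.
rewrite preimage_setT (fubini_tonelli1 (f \o @cons_rV R d))//.
- apply: measurableT_comp => //; exact: measurable_cons_rV.
- by move=> z; exact: f0.
Qed.

(** The Lebesgue measure is determined by its values on half-open
    intervals. *)
Lemma lebesgue_measureZ (t : R) (A : set R) : (0 < t)%R -> measurable A ->
  pushforward lebesgue_measure ( *%R t : measurableTypeR R -> measurableTypeR R) A
  = (t^-1)%:E * lebesgue_measure A.
Proof.
move=> t0 mA.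
have mt : measurable_fun setT ( *%R t : measurableTypeR R -> measurableTypeR R).
  exact: mulrl_measurable.
have ti0 : (0 <= t)%R by exact: ltW.
transitivity (t^-1%:E * (t%:E * pushforward lebesgue_measure
    ( *%R t : measurableTypeR R -> measurableTypeR R) A)).
  by rewrite muleA -EFinM mulVf ?gt_eqF// mul1e.
congr (_ * _).
pose pf := [the measure _ _ of pushforward lebesgue_measure
    ( *%R t : measurableTypeR R -> measurableTypeR R)].
pose m := [the measure _ _ of mscale (NngNum ti0) (pf mt)].
apply/esym; rewrite (@lebesgue_measure_unique R m)//.
move=> _ [[a b]] _ <-; rewrite /m/= /mscale/= /pushforward.
have -> : *%R t @^-1` `]a, b] = [set` `](a / t)%R, (b / t)%R]].
  apply/seteqP; split => x /=; rewrite !in_itv/= ltr_pdivrMr// ler_pdivlMr//;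
    by rewrite mulrC.
rewrite !lebesgue_measure_itv/= !lte_fin ltr_pM2r ?invr_gt0//.
case: ifPn => _; rewrite ?mule0// -!EFinB -EFinM; congr EFin.
by field; rewrite gt_eqF.
Qed.

Lemma ge0_integralZ_lebesgue (t : R) (f : R -> \bar R) : (0 < t)%R ->
  measurable_fun setT f -> (forall x, 0 <= f x) ->
  \int[lebesgue_measure]_x f (t * x)%R
  = (t^-1)%:E * \int[lebesgue_measure]_x f x.
Proof.
move=> t0 mf f0.
have mt : measurable_fun setT ( *%R t : measurableTypeR R -> measurableTypeR R).
  exact: mulrl_measurable.
have ti0 : (0 <= t^-1)%R by rewrite invr_ge0 ltW.
rewrite -(ge0_integral_mscale lebesgue_measure measurableT (NngNum ti0))//.
transitivity (\int[pushforward lebesgue_measure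
    ( *%R t : measurableTypeR R -> measurableTypeR R)]_x f x).
  by rewrite ge0_integral_pushforward.
apply: eq_measure_integral => A mA _ /=.
by rewrite lebesgue_measureZ.
Qed.

Lemma measurable_scale_rV d (t : R) : measurable_fun setT
  (fun x : borel_rV R d => t *: (x : 'rV[R]_d) : borel_rV R d).
Proof.
apply: (@measurability _ _ (borel_rV R d) (borel_rV R d) _ _
  (open : set (set 'rV[R]_d))) => //.
move=> _ [U oU <-]; rewrite setTI; apply: open_borel_rV.
move: U oU; apply/continuousP; exact: scaler_continuous.
Qed.

(** Induction on the dimension with Tonelli's theorem, one factor t^-1 for each
    coordinate. *)
Lemma ge0_integralZ_lebesgue_rV d (t : R) (f : borel_rV R d -> \bar R) :
  (0 < t)%R -> measurable_fun setT f -> (forall x, 0 <= f x) ->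
  \int[lebesgue_rV R d]_x f (t *: (x : 'rV[R]_d))
  = (t ^- d)%:E * \int[lebesgue_rV R d]_x f x.
Proof.
move=> t0; elim: d f => [|d IH] f mf f0.
  rewrite expr0 invr1 mul1e /=.
  apply: eq_integral => x _; congr f; apply/rowP; case => //.
rewrite !ge0_integral_lebesgue_rVS//; last first.
  exact: (measurableT_comp mf (measurable_scale_rV _)).
pose F x := \int[lebesgue_rV R d]_v f (cons_rV (x, v)).
have mfc : measurable_fun setT (f \o @cons_rV R d).
  by apply: measurableT_comp => //; exact: measurable_cons_rV.
have mF : measurable_fun setT F.
  exact: (@measurable_fun_fubini_tonelli_F _ _ _ _ _ (lebesgue_rV R d)
    (f \o @cons_rV R d) mfc (fun z => f0 _)).
have F0 x : 0 <= F x by exact: integral_ge0.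
transitivity (\int[lebesgue_measure]_x ((t ^- d)%:E * F (t * x)%R)).
  apply: eq_integral => x _; rewrite -IH.
  - apply: eq_integral => v _; congr f.
    rewrite /cons_rV; apply/rowP => i; rewrite !mxE.
    by case: splitP => j _; rewrite !mxE.
  - exact: (measurableT_comp mfc (pair1_measurable (t * x)%R)).
  - by [].
have td0 : (0 <= t ^- d)%R by rewrite invr_ge0 exprn_ge0// ltW.
have mFt : measurable_fun setT (fun x : measurableTypeR R => F (t * x)%R).
  by apply: measurableT_comp => //; exact: mulrl_measurable.
rewrite (ge0_integralZlT lebesgue_measure td0 mFt (fun x => F0 _)).
by rewrite ge0_integralZ_lebesgue// muleA -EFinM -invfM -exprSr.
Qed.

Definition box_rV (d : nat) (a b : R) : set (borel_rV R d) :=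
  [set x | forall i, (x : 'rV[R]_d) 0%R i \in `[a, b]%R].

Lemma measurable_box_rV (d : nat) (a b : R) : measurable (@box_rV d a b).
Proof.
have -> : @box_rV d a b =
    \bigcap_(i : 'I_d) ((fun x : borel_rV R d => (x : 'rV[R]_d) 0%R i) @^-1` `[a, b]).
  by apply/seteqP; split=> [x bx i _|x bx i]; [exact: bx|exact: bx].
apply: fin_bigcap_measurable => // i _.
rewrite -[X in measurable X]setTI; apply: continuous_measurable_rV => //.
exact: coord_continuous.
Qed.

Lemma lebesgue_rV_box (d : nat) (a b : R) : (a <= b)%R ->
  lebesgue_rV R d (@box_rV d a b) = ((b - a) ^+ d)%:E.
Proof.
move=> ab; elim: d => [|d IH].
  by rewrite expr0 /= diracE mem_set//= => -[].
transitivity ((lebesgue_measure \x lebesgue_rV R d)%E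
    (@cons_rV R d @^-1` @box_rV d.+1 a b)); first by [].
have -> : @cons_rV R d @^-1` @box_rV d.+1 a b = `[a, b] `*` @box_rV d a b.
  apply/seteqP; split=> -[x v]; rewrite /box_rV /cons_rV /= => H.
    split=> [|i].
      have : row_mx (const_mx x : 'rV[R]_1) (v : 'rV[R]_d) 0%R (lshift d ord0)
          \in `[a, b]%R by exact: (H (@lshift 1 d ord0)).
      by rewrite row_mxEl mxE.
    have : row_mx (const_mx x : 'rV[R]_1) (v : 'rV[R]_d) 0%R (rshift 1 i)
        \in `[a, b]%R by exact: (H (@rshift 1 d i)).
    by rewrite row_mxEr.
  case: H => xab vab i; rewrite mxE; case: splitP => j _; last exact: vab.
  by rewrite mxE.
rewrite product_measure1E//; last exact: measurable_box_rV.
rewrite IH/= lebesgue_measure_itv/= lte_fin exprS EFinM.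
have [//|ba] := ltP a b.
have -> : a = b by apply/le_anti; rewrite ab ba.
by rewrite subrr !mul0e.
Qed.

End lebesgue_rV_theory.

(** * Calculus along lines and rays *)

Section calculus.
Context (R : realType).

(** The mean value theorem between 0 and b, whatever the sign of b. *)
Lemma MVT0 (g dg : R -> R) (b : R) : (forall x : R, is_derive x 1 g (dg x)) ->
  exists2 z, `|z| <= `|b| & g b - g 0 = dg z * b.
Proof.
move=> gdg.
have cg : continuous g.
  by move=> x; apply/differentiable_continuous/derivable1_diffP;
    have [] := gdg x.
have [b0|b0] := leP 0 b.
  have [|z] := @MVT_segment R g dg 0 b b0 (fun x _ => gdg x).
    exact: continuous_subspaceT.
  rewrite in_itv/= subr0 => /andP[z0 zb] ->; exists z => //.
  by rewrite !ger0_norm.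
have [|z] := @MVT_segment R g dg b 0 (ltW b0) (fun x _ => gdg x).
  exact: continuous_subspaceT.
rewrite in_itv/= sub0r => /andP[bz z0] E; exists z.
  by rewrite !ler0_norm ?lerN2// ltW.
by rewrite -opprB E mulrN opprK.
Qed.

(** The two difference quotients are the same function of the increment. *)
Lemma is_derive_line (V : normedModType R) (f : V -> R) (y v : V) (s : R) :
  derivable f (s *: v + y) v ->
  is_derive s 1 (fun t => f (t *: v + y)) ('D_v f (s *: v + y)).
Proof.
move=> df.
have E : (fun h => h^-1 *: (((fun t : R => f (t *: v + y)) \o shift s) (h *: 1)
    - f (s *: v + y)))
  = (fun h => h^-1 *: ((f \o shift (s *: v + y)) (h *: v) - f (s *: v + y))).
  apply/funext => h /=; congr (_ *: (f _ - _)).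
  by rewrite scalerDl addrA -scalerA scale1r.
split; first by rewrite /derivable E.
by rewrite /derive E.
Qed.

(** Continuous partial derivatives determine all directional derivatives.  The
    increment f (x + h v) - f x is telescoped over the partial sums w k of the
    coordinates of v, and each term is a mean value of one partial derivative at
    a point that tends to x with h. *)
Lemma is_derive_partials d (f : 'rV[R]_d -> R) (x v : 'rV[R]_d) :
  (forall i x, derivable f x (delta_mx 0 i)) ->
  (forall i, continuous (partial i f)) ->
  is_derive x v f (\sum_i v 0 i * partial i f x).
Proof.
move=> df cf.
pose w (k : nat) : 'rV[R]_d := \row_j (if (j < k)%N then v 0 j else 0).
have wS (k : 'I_d) : w k.+1 = w k + v 0 k *: delta_mx 0 k.
  apply/rowP => j; rewrite !mxE/= ltnS leq_eqVlt.
  case: (eqVneq j k) => [->|jk]; first by rewrite eqxx/= ltnn mulr1 add0r.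
  by rewrite (negbTE (_ : (j : nat) != k))// mulr0 addr0.
have step (k : 'I_d) (h : R) : exists z : 'rV[R]_d,
    `|z - x| <= `|h| * `|v| /\
    f (h *: w k.+1 + x) - f (h *: w k + x) = h * (v 0 k * partial k f z).
  have [z zb E] := @MVT0 (fun s => f (s *: delta_mx 0 k + (h *: w k + x)))
    (fun s => partial k f (s *: delta_mx 0 k + (h *: w k + x))) (h * v 0 k)
    (fun s => is_derive_line (df k _)).
  exists (z *: delta_mx 0 k + (h *: w k + x)); split.
    rewrite addrA addrK [leLHS]/Num.Def.normr/= mx_normrE.
    apply/bigmax_leP; split => [|[i j] _]; first by rewrite mulr_ge0.
    rewrite !mxE/= ord1 eqxx/=.
    have vj l : `|v 0 l| <= `|v|.
      by rewrite [leRHS]/Num.Def.normr/= mx_normrE; apply: (le_bigmax _ _ (0, l)).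
    case: (eqVneq j k) => [->|jk]; rewrite ?ltnn ?mulr1 ?mulr0 ?addr0 ?add0r.
      by rewrite (le_trans zb)// normrM ler_wpM2l.
    case: ifPn => _; rewrite ?mulr0 ?normr0 ?mulr_ge0//.
    by rewrite normrM ler_wpM2l.
  rewrite mulrA [LHS](_ : _ = partial k f (z *: delta_mx 0 k + (h *: w k + x))
    * (h * v 0 k)) 1?mulrC//.
  rewrite [in X in _ = X]mulrC -E scale0r add0r wS scalerDr scalerA; congr (f _ - _).
  by rewrite addrA [in LHS](addrC (h *: w k)).
pose z k h := sval (cid (step k h)).
have zx k : z k h @[h --> 0^'] --> x.
  apply/cvgrPdist_le => /= e e0; near=> h.
  rewrite distrC (le_trans (svalP (cid (step k h))).1)//.
  rewrite (le_trans (_ : _ <= `|h| * (`|v| + 1))) ?ler_wpM2l ?lerDl//.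
  rewrite -ler_pdivlMr ?ltr_wpDl//.
  near: h; apply: dnbhs0_le; rewrite divr_gt0 ?ltr_wpDl//.
have H : h^-1 *: (f (h *: v + x) - f x) @[h --> 0^'] -->
    \sum_i v 0 i * partial i f x.
  apply: (@cvg_trans _ ((\sum_i v 0 i * partial i f (z i h)) @[h --> 0^'])).
    apply: near_eq_cvg; near=> h.
    have h0 : h != 0 by near: h; exact: nbhs_dnbhs_neq.
    have -> : f (h *: v + x) - f x =
        \sum_(i < d) (f (h *: w i.+1 + x) - f (h *: w i + x)).
      rewrite -(big_mkord xpredT (fun i => f (h *: w i.+1 + x) - f (h *: w i + x))).
      rewrite telescope_sumr//; congr (f (h *: _ + _) - f _).
        by apply/rowP => j; rewrite mxE ltn_ord.
      rewrite (_ : w 0%N = 0) ?scaler0 ?add0r//.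
      by apply/rowP => j; rewrite !mxE.
    rewrite scaler_sumr; apply: eq_bigr => i _.
    by rewrite (svalP (cid (step i h))).2 /GRing.scale/= mulKf.
  apply: cvg_big => [|i _]; first exact: add_continuous.
  apply: cvgMl_tmp.
  by apply: (cvg_comp _ _ (zx i)); exact: cf.
split; first by apply/cvg_ex; eexists; exact: H.
exact/cvg_lim.
Unshelve. all: by end_near. Qed.

Lemma norm_le_cvg0 (T : Type) (F : set_system T) (FF : Filter F) (f g : T -> R) :
  (\forall x \near F, `|f x| <= g x) -> g x @[x --> F] --> (0 : R) ->
  f x @[x --> F] --> (0 : R).
Proof.
move=> fg g0; apply: (@squeeze_cvgr _ _ _ _ (fun x => - g x) g f _ 0) => //.
  by near do rewrite -ler_norml.
by rewrite -oppr0; exact: cvgN.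
Unshelve. all: by end_near. Qed.

(** At 0, where t `^ q is not differentiable in general, |y| < e `^ q^-1 forces
    |y| `^ q < e. *)
Lemma continuous_powR_norm (q : R) : 0 < q -> continuous (fun y : R => `|y| `^ q).
Proof.
move=> q0 y; have qn0 : q != 0 by rewrite gt_eqF.
have [->|y0] := eqVneq y 0.
  rewrite /continuous_at normr0 powR0 ?gt_eqF//.
  apply/cvgrPdist_lt => /= e e0; near=> z.
  rewrite sub0r normrN ger0_norm ?powR_ge0//.
  rewrite -(@powRr1 _ e) ?ltW// -(mulVf qn0) powRrM.
  rewrite gt0_ltr_powR ?nnegrE ?powR_ge0//.
  near: z; apply: (@nbhs0_lt _ R); exact: powR_gt0.
rewrite -[fun _ => _]/((fun z : R => z `^ q) \o (fun z : R => `|z|)).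
apply: continuous_comp; first exact: norm_continuous.
apply/differentiable_continuous/derivable1_diffP.
have y0' : 0 < `|y| by rewrite normr_gt0.
by have [] := is_derive1_powR q y0'.
Unshelve. all: by end_near. Qed.

Definition dabsp (p y : R) := p * `|y| `^ (p - 1) * Num.sg y.

(** At 0 the difference quotient has modulus |h| `^ (p - 1), which tends to 0
    because p > 1. *)
Lemma is_derive_absp (p y : R) : 1 < p ->
  is_derive y 1 (fun z => `|z| `^ p) (dabsp p y).
Proof.
move=> p1; have p0 : 0 < p by exact: lt_trans p1.
rewrite /dabsp; case: (ltgtP y 0) => [y0|y0|->].
- rewrite ltr0_norm// ltr0_sg// mulrN1.
  apply: (@near_eq_is_derive R R R (fun z : R => (- z) `^ p)).
    near=> z => /=; rewrite ltr0_norm//.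
    by near: z; exact: lt_nbhsl.
  have Ny0 : 0 < - y by rewrite oppr_gt0.
  have dN : is_derive y (1:R) (-%R : R -> R) (- 1) by exact: is_deriveNid.
  have dp := is_derive1_powR p Ny0.
  by have := @is_derive1_comp _ (fun z : R => z `^ p) _ _ _ _ dp dN; rewrite mulrN1.
- rewrite gtr0_norm// gtr0_sg// mulr1.
  apply: (@near_eq_is_derive R R R (fun z : R => z `^ p)); last exact: is_derive1_powR.
  near=> z => /=; rewrite gtr0_norm//.
  by near: z; exact: lt_nbhsr.
- rewrite sgr0 mulr0.
  have H : h^-1 *: (((fun z : R => `|z| `^ p) \o shift 0) (h *: 1) - `|0 : R| `^ p)
      @[h --> (0:R)^'] --> (0 : R).
    apply: (@norm_le_cvg0 _ _ _ _ (fun h => `|h| `^ (p - 1))).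
      near=> h.
      have h0 : h != 0 by near: h; exact: nbhs_dnbhs_neq.
      rewrite /= addr0 /GRing.scale/= mulr1 normr0 powR0 ?gt_eqF// subr0.
      rewrite normrM normfV (ger0_norm (powR_ge0 _ _)).
      by rewrite -(mulr_powRB1 (normr_ge0 h) p0) mulKf// normr_eq0.
    have q0 : 0 < p - 1 by rewrite subr_gt0.
    have := @continuous_powR_norm _ q0 0.
    rewrite /continuous_at normr0 powR0 ?gt_eqF// => H.
    exact: cvg_within_filter.
  split; first by apply/cvg_ex; eexists; exact: H.
  exact/cvg_lim.
Unshelve. all: by end_near. Qed.

Lemma continuous_dabsp (p : R) : 1 < p -> continuous (dabsp p).
Proof.
move=> p1 y; have q0 : 0 < p - 1 by rewrite subr_gt0.
have C := @continuous_powR_norm _ q0 y.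
have Cp : p * `|z| `^ (p - 1) @[z --> y] --> p * `|y| `^ (p - 1).
  exact: cvgMl_tmp.
rewrite /continuous_at /dabsp; case: (ltgtP y 0) => [y0|y0|y0].
- rewrite (ltr0_sg y0); apply: (@cvg_trans _
    ((p * `|z| `^ (p - 1) * -1) @[z --> y])); last exact: (cvgM Cp (cvg_cst _)).
  apply: near_eq_cvg; near=> z; rewrite ltr0_sg//.
  by near: z; exact: lt_nbhsl.
- rewrite (gtr0_sg y0); apply: (@cvg_trans _
    ((p * `|z| `^ (p - 1) * 1) @[z --> y])); last exact: (cvgM Cp (cvg_cst _)).
  apply: near_eq_cvg; near=> z; rewrite gtr0_sg//.
  by near: z; exact: lt_nbhsr.
- rewrite y0 sgr0 mulr0; apply: (@norm_le_cvg0 _ _ _ _ (fun z => p * `|z| `^ (p - 1))); last first.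
    by move: Cp; rewrite y0 normr0 powR0 ?gt_eqF// mulr0.
  near=> z.
  rewrite 2!normrM (ger0_norm (powR_ge0 _ _)) (gtr0_norm (lt_trans ltr01 p1)).
  have [->|z0] := eqVneq z 0; first by rewrite normr0 powR0 ?gt_eqF// !(mulr0,mul0r).
  by rewrite normr_sg z0 mulr1.
Unshelve. all: by end_near. Qed.

End calculus.

(** * The Euclidean norm and the quadratic form *)

Section euclid.
Context (R : realType).
Implicit Types d : nat.

Lemma enorm_ge0 d (x : 'rV[R]_d) : 0 <= enorm x.
Proof. exact: sqrtr_ge0. Qed.

Lemma sqr_enorm d (x : 'rV[R]_d) : enorm x ^+ 2 = \sum_i x 0 i ^+ 2.
Proof. by rewrite sqr_sqrtr// sumr_ge0// => i _; rewrite sqr_ge0. Qed.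

Lemma enormZ d (t : R) (x : 'rV[R]_d) : enorm (t *: x) = `|t| * enorm x.
Proof.
rewrite /enorm -sqrtr_sqr -sqrtrM ?sqr_ge0//; congr Num.sqrt.
by rewrite mulr_sumr; apply: eq_bigr => i _; rewrite mxE exprMn.
Qed.

Lemma ler_coord_enorm d (x : 'rV[R]_d) i : `|x 0 i| <= enorm x.
Proof.
rewrite -sqrtr_sqr ler_wsqrtr// (bigD1 i)//= lerDl.
by rewrite sumr_ge0// => j _; rewrite sqr_ge0.
Qed.

Lemma enorm_gt0 d (x : 'rV[R]_d) : x != 0 -> 0 < enorm x.
Proof.
move=> x0; rewrite lt_neqAle enorm_ge0 andbT eq_sym; apply: contra x0 => /eqP e0.
apply/eqP/rowP => i; rewrite mxE; apply/eqP.
by rewrite -normr_le0 -e0 ler_coord_enorm.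
Qed.

Lemma enorm0 d : enorm (0 : 'rV[R]_d) = 0.
Proof.
by rewrite /enorm big1 ?sqrtr0// => i _; rewrite mxE expr0n.
Qed.

(** Expand the sum of the squares (|x|^2 y_i - S x_i)^2, where S is the scalar
    product. *)
Lemma CauchySchwarz_rV d (x y : 'rV[R]_d) :
  `|\sum_i x 0 i * y 0 i| <= enorm x * enorm y.
Proof.
have [->|x0] := eqVneq x 0.
  by rewrite big1 ?normr0 ?mulr_ge0 ?enorm_ge0// => i _; rewrite mxE mul0r.
set X := enorm x; set Y := enorm y; set S := \sum_i _.
have SE : \sum_i x 0 i * y 0 i = S by [].
clearbody S.
have X0 : 0 < X by exact: enorm_gt0.
have Y0 : 0 <= Y by exact: enorm_ge0.
rewrite -ler_sqr ?nnegrE ?mulr_ge0// ?(ltW X0)// real_normK ?num_real//.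
have : 0 <= \sum_i (X ^+ 2 * y 0 i - S * x 0 i) ^+ 2.
  by rewrite sumr_ge0// => i _; rewrite sqr_ge0.
have -> : \sum_i (X ^+ 2 * y 0 i - S * x 0 i) ^+ 2 =
    X ^+ 4 * Y ^+ 2 - X ^+ 2 * S * S *+ 2 + S ^+ 2 * X ^+ 2.
  transitivity (X ^+ 4 * (\sum_i y 0 i ^+ 2) - X ^+ 2 * S *+ 2 *
      (\sum_i x 0 i * y 0 i) + S ^+ 2 * \sum_i x 0 i ^+ 2).
    by rewrite !mulr_sumr -sumrB -big_split/=; apply: eq_bigr => i _; ring.
  by rewrite SE -!sqr_enorm -/X -/Y; ring.
move=> H; have : 0 <= X ^+ 2 * ((X * Y) ^+ 2 - S ^+ 2) by lra.
by rewrite pmulr_rge0 ?exprn_gt0// subr_ge0.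
Qed.

Lemma continuous_sumr (T : topologicalType) (I : Type) (r : seq I) (F : I -> T -> R) :
  (forall i, continuous (F i)) -> continuous (fun x => \sum_(i <- r) F i x).
Proof.
move=> cF; apply: continuous_big => [|i _]; last exact: cF.
exact: add_continuous.
Qed.

Lemma continuous_enorm d : continuous (@enorm R d).
Proof.
move=> x; apply: (@continuous_comp _ _ _ (fun x : 'rV[R]_d => \sum_i x 0 i ^+ 2)
  Num.sqrt); last exact: sqrt_continuous.
apply: continuous_sumr => i {}x.
apply: (@continuous_comp _ _ _ (fun x : 'rV[R]_d => x 0 i) (fun z => z ^+ 2)).
  exact: coord_continuous.
exact: exprn_continuous.
Qed.

Lemma quad_formZ d (A : 'M[R]_d) (t : R) x :
  quad_form A (t *: x) = t ^+ 2 * quad_form A x.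
Proof.
by rewrite /quad_form linearZ/= -!scalemxAl -scalemxAr scalerA mxE expr2.
Qed.

Lemma quad_formE d (A : 'M[R]_d) x :
  quad_form A x = \sum_i \sum_j x 0 i * A i j * x 0 j.
Proof.
rewrite /quad_form mxE exchange_big/=; apply: eq_bigr => j _.
by rewrite !mxE mulr_suml; apply: eq_bigr => i _.
Qed.

(** One may take for C one plus the sum of the moduli of the entries of A. *)
Lemma quad_form_le d (A : 'M[R]_d) :
  exists2 C, 0 < C & forall x, quad_form A x <= C * enorm x ^+ 2.
Proof.
exists (1 + \sum_i \sum_j `|A i j|).
  by rewrite ltr_wpDr// sumr_ge0// => i _; rewrite sumr_ge0.
move=> x; rewrite quad_formE mulrDl mul1r ler_wpDl ?sqr_ge0//.
rewrite mulr_suml ler_sum// => i _; rewrite mulr_suml ler_sum// => j _.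
rewrite (le_trans (ler_norm _))// !normrM mulrAC mulrC.
by rewrite ler_wpM2l// expr2 ler_pM// ler_coord_enorm.
Qed.

Lemma continuous_quad_form d (A : 'M[R]_d) : continuous (quad_form A).
Proof.
rewrite (_ : quad_form A = fun x => \sum_i \sum_j x 0 i * A i j * x 0 j);
  last by apply/funext => y; rewrite quad_formE.
apply: continuous_sumr => i; apply: continuous_sumr => j x.
have cx (k : 'I_d) : (y : 'rV[R]_d) 0 k @[y --> x] --> x 0 k.
  exact: coord_continuous.
exact: (cvgM (cvgM (cx i) (cvg_cst _)) (cx j)).
Qed.

(** The conjugate exponent of p is p / (p - 1). *)
Lemma Young_powR (p a b : R) : 1 < p -> 0 <= a -> 0 <= b ->
  p * (a * b `^ (p - 1)) <= a `^ p + (p - 1) * b `^ p.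
Proof.
move=> p1 a0 b0; have p0 : 0 < p by exact: lt_trans p1.
have q0 : 0 < p - 1 by rewrite subr_gt0.
have pq : p^-1 + (p / (p - 1))^-1 = 1.
  by rewrite invf_div -[in X in X + _](mul1r p^-1) -mulrDl addrC subrK divff ?gt_eqF.
have := conjugate_powR a0 (powR_ge0 b (p - 1)) p0 (divr_gt0 p0 q0) pq.
rewrite -powRrM (_ : (p - 1) * (p / (p - 1)) = p); last first.
  by rewrite mulrC divfK ?gt_eqF.
move=> H; rewrite (le_trans (ler_wpM2l (ltW p0) H))// le_eqVlt; apply/orP; left.
by apply/eqP; field; rewrite !gt_eqF.
Qed.

End euclid.

(** * Averages over dilations *)

Section ray.
Context (R : realType).

Lemma is_derive_LRcontinuous (F f : R -> R) a b :
  (forall t : R, is_derive t 1 F (f t)) -> derivable_oo_LRcontinuous F a b.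
Proof.
move=> dF; have cF : continuous F.
  by move=> t; apply/differentiable_continuous/derivable1_diffP; have [] := dF t.
split=> [t _||]; first by have [] := dF t.
- by apply: cvg_at_right_filter; exact: cF.
- by apply: cvg_at_left_filter; exact: cF.
Qed.

(** The derivative f may change sign, so it is kept out of the integrals: if the
    integral of N is finite the inequality is integrated as it stands, and
    otherwise the right-hand side is infinite. *)
Lemma ge0_le_integral_FTC (P N F f : R -> R) :
  measurable_fun setT P -> measurable_fun setT N ->
  (forall t, 0 <= P t) -> (forall t, 0 <= N t) ->
  (forall t : R, is_derive t 1 F (f t)) -> continuous f ->
  (forall t, P t <= N t + f t) ->
  (\int[lebesgue_measure]_(t in `[0%R, 1%R]) (P t)%:E + (F 0)%:E <=
   \int[lebesgue_measure]_(t in `[0%R, 1%R]) (N t)%:E + (F 1)%:E)%E.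
Proof.
move=> mP mN P0 N0 dF cf PNf.
set mu := lebesgue_measure; set D := `[0, 1]%classic.
have IN0 : (0 <= \int[mu]_(t in D) (N t)%:E)%E.
  by apply: integral_ge0 => t _; rewrite lee_fin.
have [IN|IN] := eqVneq (\int[mu]_(t in D) (N t)%:E)%E +oo%E.
  by rewrite IN addye// leey.
have intN : mu.-integrable D (EFin \o N).
  apply/integrableP; split; first exact/measurable_EFinP/measurable_funTS.
  rewrite (_ : (fun x => _) = EFin \o N); first by rewrite ltey.
  by apply/funext => t /=; rewrite ger0_norm.
have intf : mu.-integrable D (EFin \o f).
  apply: continuous_compact_integrable; first exact: segment_compact.
  exact: continuous_subspaceT.
have If : (\int[mu]_(t in D) (f t)%:E = (F 1)%:E - (F 0)%:E)%E.
  apply: continuous_FTC2 => //; first exact: continuous_subspaceT.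
  - exact: is_derive_LRcontinuous.
  - by move=> t _; rewrite derive1E; have [] := dF t.
have H : (\int[mu]_(t in D) (P t)%:E <= \int[mu]_(t in D) (N t + f t)%:E)%E.
  apply: ge0_le_integral => //.
  - exact: measurable_itv.
  - by move=> t _; rewrite lee_fin.
  - exact/measurable_EFinP/measurable_funTS.
  - apply/measurable_EFinP/measurable_funTS/measurable_funD => //.
    exact: continuous_measurable_fun.
  - by move=> t _; rewrite lee_fin; exact: PNf.
rewrite -leeBrDr//; apply: (le_trans H).
have -> : (\int[mu]_(t in D) (N t + f t)%:E =
    \int[mu]_(t in D) (N t)%:E + \int[mu]_(t in D) (f t)%:E)%E.
  by rewrite -(integralD _ intN intf)//; exact: measurable_itv.
by rewrite If addeA.
Qed.

End ray.

Section average.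
Context (R : realType) (d : nat).

(** The product sigma-algebra is compared with the Borel sets through cons_rV,
    which is measurable; after it the map is continuous on row vectors. *)
Lemma measurable_dilation : measurable_fun setT
  (fun z : measurableTypeR R * borel_rV R d =>
     expR z.1 *: (z.2 : 'rV[R]_d) : borel_rV R d).
Proof.
pose S (y : borel_rV R d.+1) : borel_rV R d :=
  expR ((y : 'rV[R]_d.+1) 0 0) *: (rsubmx (y : 'rV[R]_(1 + d))).
have -> : (fun z : measurableTypeR R * borel_rV R d =>
     expR z.1 *: (z.2 : 'rV[R]_d) : borel_rV R d) = S \o @cons_rV R d.
  apply/funext => -[t v]; rewrite /S /cons_rV /= row_mxKr mxE.
  by case: splitP => // j _; rewrite mxE.
apply: measurableT_comp; last exact: measurable_cons_rV.
apply: (@measurability _ _ (borel_rV R d.+1) (borel_rV R d) _ _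
  (open : set (set 'rV[R]_d))) => //.
move=> _ [U oU <-]; rewrite setTI; apply: open_borel_rV.
move: U oU; apply/continuousP => y.
have c1 : continuous (fun y : 'rV[R]_d.+1 => expR (y 0 0)).
  move=> {}y; apply: (@continuous_comp _ _ _ (fun y : 'rV[R]_d.+1 => y 0 0) expR).
    exact: coord_continuous.
  exact: continuous_expR.
have c2 : continuous (fun y : 'rV[R]_d.+1 => rsubmx (y : 'rV[R]_(1 + d))).
  exact: (@continuous_rsubmx R 1 1 d).
exact: (cvgZ (c1 y) (c2 y)).
Qed.

Lemma measurable_dilation_density (P : borel_rV R d -> R) :
  measurable_fun setT P ->
  measurable_fun setT (fun z : measurableTypeR R * borel_rV R d =>
    (expR (d%:R * z.1) * P (expR z.1 *: (z.2 : 'rV[R]_d)) *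
     \1_(`[0%R, 1%R]) z.1)%:E).
Proof.
move=> mP.
have mI : measurable_fun setT (\1_(`[0%R, 1%R]%classic) : measurableTypeR R -> R).
  by apply: measurable_indic; exact: measurable_itv.
apply/measurable_EFinP; apply: measurable_funM; last first.
  exact: (measurableT_comp mI measurable_fst).
apply: measurable_funM; last exact: (measurableT_comp mP measurable_dilation).
by apply: measurableT_comp => //; apply: measurable_funM.
Qed.

Lemma integral_dilation_indic (P : borel_rV R d -> R) (x : borel_rV R d) :
  (\int[lebesgue_measure]_(t in `[0%R, 1%R])
      (expR (d%:R * t) * P (expR t *: (x : 'rV[R]_d)))%:E =
   \int[lebesgue_measure]_t
      (expR (d%:R * t) * P (expR t *: (x : 'rV[R]_d)) * \1_(`[0%R, 1%R]) t)%:E)%E.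
Proof.
rewrite integral_mkcond.
by apply: eq_integral => t _; rewrite epatch_indic EFinM.
Qed.

Lemma measurable_dilation_average (P : borel_rV R d -> R) :
  measurable_fun setT P -> (forall x, 0 <= P x) ->
  measurable_fun setT (fun x : borel_rV R d =>
    \int[lebesgue_measure]_(t in `[0%R, 1%R])
      (expR (d%:R * t) * P (expR t *: (x : 'rV[R]_d)))%:E)%E.
Proof.
move=> mP P0; rewrite (funext (integral_dilation_indic P)).
apply: (measurable_fun_fubini_tonelli_G (m1 := @lebesgue_measure R) _
  (measurable_dilation_density mP)) => z.
by rewrite lee_fin !mulr_ge0 ?expR_ge0.
Qed.

(** Tonelli's theorem exchanges the two integrals, and e^(d t) is exactly the
    factor lost when x is replaced by e^t x. *)
Lemma integral_dilation_average (P : borel_rV R d -> R) :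
  measurable_fun setT P -> (forall x, 0 <= P x) ->
  (\int[lebesgue_rV R d]_x \int[lebesgue_measure]_(t in `[0%R, 1%R])
      (expR (d%:R * t) * P (expR t *: (x : 'rV[R]_d)))%:E =
   \int[lebesgue_rV R d]_x (P x)%:E)%E.
Proof.
move=> mP P0.
have mPhi := measurable_dilation_density mP.
set Phi := (X in measurable_fun _ X) in mPhi.
have Phi0 z : (0 <= Phi z)%E.
  by rewrite lee_fin !mulr_ge0 ?expR_ge0.
transitivity (\int[lebesgue_rV R d]_x \int[lebesgue_measure]_t Phi (t, x))%E.
  by apply: eq_integral => x _; rewrite integral_dilation_indic.
rewrite -fubini_tonelli//.
transitivity (\int[lebesgue_measure]_(t in `[0%R, 1%R])
    \int[lebesgue_rV R d]_x (P x)%:E)%E.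
  rewrite [RHS]integral_mkcond; apply: eq_integral => t _; rewrite patchE/=.
  case: ifPn => [tD|tD]; last first.
    rewrite integral0_eq// => x _; rewrite /Phi indicE (negbTE tD) mulr0//.
  transitivity (\int[lebesgue_rV R d]_x ((expR (d%:R * t))%:E *
      (P (expR t *: (x : 'rV[R]_d)))%:E))%E.
    by apply: eq_integral => x _; rewrite /Phi indicE tD mulr1 EFinM.
  have mPe : measurable_fun setT (EFin \o P) by exact/measurable_EFinP.
  have mPt := measurableT_comp mPe (@measurable_scale_rV R d (expR t)).
  rewrite (ge0_integralZlT _ (expR_ge0 _) mPt); last by move=> x; rewrite lee_fin.
  rewrite (ge0_integralZ_lebesgue_rV (expR_gt0 t) mPe)//.
  by rewrite muleA -EFinM expRM_natl mulfV ?mul1e// expf_neq0// gt_eqF// expR_gt0.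
rewrite integral_cst//= lebesgue_measure_itv/= lte_fin ltr01 oppr0 adde0 mule1//.
Qed.

Lemma compact_rV_bounded (K : set 'rV[R]_d) : compact K ->
  exists2 M, 0 <= M & forall x, K x -> forall i, `|x 0 i| <= M.
Proof.
move=> /compact_bounded [M [Mr HM]].
exists (`|M| + 1) => [|x Kx i]; first by rewrite addr_ge0.
have MM : M < `|M| + 1 by rewrite (le_lt_trans (ler_norm M))// ltrDl.
apply: le_trans (HM _ MM _ Kx).
by rewrite [leRHS]/Num.Def.normr/= mx_normrE; apply: (le_bigmax _ _ (0, i)).
Qed.

(** A continuous function on a compact set is bounded, and the set lies in a
    box. *)
Lemma integral_compact_lty (K : set 'rV[R]_d) (f : borel_rV R d -> R) :
  compact K -> measurable_fun setT f -> (forall x, 0 <= f x) ->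
  (forall x, ~ K x -> f x = 0) ->
  (forall x, K x -> {for (x : 'rV[R]_d), continuous (f : 'rV[R]_d -> R)}) ->
  (\int[lebesgue_rV R d]_x (f x)%:E < +oo)%E.
Proof.
move=> cK mf f0 fK cf.
have [B B0 fB] : exists2 B, 0 <= B & forall x, f x <= B.
  have [K0|K0] := pselect (K !=set0); last first.
    by exists 0 => // x; rewrite fK// => Kx; apply: K0; exists x.
  have [|c cK' fc] := @EVT_max_rV R d f K K0 cK.
    by apply: continuous_in_subspaceT => x /[!inE]; exact: cf.
  exists (f c) => // x; have [Kx|Kx] := pselect (K x); last by rewrite fK.
  by apply: fc; rewrite inE.
have [M M0 KM] := compact_rV_bounded cK.
have mB := @measurable_box_rV R d (- M) M.
apply: (@le_lt_trans _ _ (\int[lebesgue_rV R d]_(x in @box_rV R d (- M) M) B%:E)%E).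
  rewrite [leRHS]integral_mkcond; apply: ge0_le_integral => //.
  - by move=> x _; rewrite lee_fin.
  - exact/measurable_EFinP.
  - by apply/(measurable_restrictT _ mB); exact: measurable_cst.
  - move=> x _; rewrite patchE; case: ifPn => [_|xB]; first by rewrite lee_fin.
    rewrite lee_fin fK// => Kx; move/negP: xB; apply; rewrite inE => i.
    by rewrite in_itv/= -ler_norml KM.
rewrite integral_cst//=.
have -> : lebesgue_rV R d (box_rV (- M) M) = ((M - - M) ^+ d)%:E.
  by rewrite lebesgue_rV_box// lerNl (le_trans _ M0)// oppr_le0.
by rewrite -EFinM ltry.
Qed.

End average.

(** * The inequality *)

Section hardy.
Context (R : realType) (d : nat) (p c a : R) (A : 'M[R]_d).
Hypotheses (p1 : 1 < p) (c0 : 0 < c) (Apsd : pos_semidef A).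
Variable u : 'rV[R]_d -> R.

Let s := p * (a + 1).
Let k := d%:R - s.
Let kap := `|k| / p.
Let sig := kap `^ (p - 1) * Num.sg k.
Let p0 : 0 < p. Proof. exact: lt_trans p1. Qed.

Definition hardy_lhs (x : 'rV[R]_d) := `|u x| `^ p / enorm x `^ s * rho p c A x.
Definition hardy_grad (x : 'rV[R]_d) :=
  enorm (gradient u x) `^ p / enorm x `^ (p * a) * rho p c A x.
Definition hardy_quad (x : 'rV[R]_d) :=
  `|u x| `^ p * quad_form A x `^ (p / 2) / enorm x `^ s * rho p c A x.

Definition euler (x : 'rV[R]_d) : R := \sum_i x 0 i * partial i u x.

(** The divergence of the field x |x|^(-s) rho |u|^p. *)
Definition hardy_div (x : 'rV[R]_d) :=
  (k * `|u x| `^ p + dabsp p (u x) * euler x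
   - quad_form A x `^ (p / 2) * `|u x| `^ p) / enorm x `^ s * rho p c A x.

(** After division by |x|^(-s) rho, this is Young's inequality for
    |x| |grad u| and kap |u|: the terms in x^t A x cancel, and
    sig k = p kap^p. *)
Lemma hardy_pointwise (x : 'rV[R]_d) : x != 0 ->
  kap `^ p * hardy_lhs x <= hardy_grad x + sig * hardy_quad x + sig * hardy_div x.
Proof.
move=> x0; have X0 := enorm_gt0 x0; set X := enorm x in X0 *.
have kap0 : 0 <= kap by rewrite divr_ge0// ltW.
pose W := (X `^ s)^-1 * rho p c A x.
have W0 : 0 <= W by rewrite mulr_ge0 ?invr_ge0 ?powR_ge0// rho_ge0.
pose G := enorm (gradient u x) * X.
have G0 : 0 <= G by rewrite mulr_ge0 ?enorm_ge0// ltW.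
have gE : hardy_grad x = G `^ p * W.
  rewrite /hardy_grad /W /G powRM ?enorm_ge0 ?(ltW X0)// -/X.
  have -> : p * a = s - p by rewrite /s; ring.
  rewrite powRB; last by apply/implyP => _; rewrite gt_eqF.
  by rewrite invfM invrK; ring.
have eG : `|euler x| <= G.
  have -> : euler x = \sum_i x 0 i * gradient u x 0 i.
    by rewrite /euler; apply: eq_bigr => i _; rewrite /gradient mxE.
  by rewrite /G mulrC; exact: CauchySchwarz_rV.
set y := `|u x|; have y0 : 0 <= y by exact: normr_ge0.
have kk : sig * k = p * kap `^ p.
  rewrite /sig -mulrA -normrEsg (_ : `|k| = p * kap); last first.
    by rewrite /kap mulrC divfK// gt_eqF.
  by rewrite mulrCA [_ * kap]mulrC mulr_powRB1.
have Y := Young_powR p1 G0 (mulr_ge0 kap0 y0).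
rewrite !(powRM _ kap0 y0) in Y.
have sd : - (p * (kap `^ (p - 1) * y `^ (p - 1)) * G) <=
    sig * (dabsp p (u x) * euler x).
  apply: (@le_trans _ _ (- `|sig * (dabsp p (u x) * euler x)|)); last first.
    by rewrite lerNl -normrN ler_norm.
  rewrite lerN2 /dabsp !normrM !(ger0_norm (powR_ge0 _ _)) (gtr0_norm p0) -/y.
  rewrite [leLHS](_ : _ = `|Num.sg k| * `|Num.sg (u x)| *
    (p * (kap `^ (p - 1) * y `^ (p - 1)) * `|euler x|)); last by ring.
  rewrite -[leRHS]mul1r ler_pM// ?mulr_ge0 ?powR_ge0// ?(ltW p0)//.
    by rewrite !normr_sg; case: (_ != _); case: (_ != _); rewrite /= ?mulr0 ?mulr1.
  by rewrite ler_wpM2l// !mulr_ge0 ?powR_ge0// ltW.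
rewrite gE /hardy_lhs /hardy_quad /hardy_div -/X -/y.
set Q := quad_form A x `^ (p / 2).
rewrite -subr_ge0 [leRHS](_ : _ = W * (G `^ p - kap `^ p * y `^ p
   + (sig * k) * y `^ p + sig * (dabsp p (u x) * euler x))); last by rewrite /W; ring.
rewrite mulr_ge0// kk; lra.
Qed.

Hypothesis du : forall i x, derivable u x (delta_mx 0 i).
Hypothesis cu : continuous u.
Hypothesis cdu : forall i, continuous (partial i u).

Section along_ray.
Variable x : 'rV[R]_d.

Let H t := expR (d%:R * t) * hardy_lhs (expR t *: x).
Let dH t := expR (d%:R * t) * hardy_div (expR t *: x).

Let K := c / enorm x `^ s.
Let q := quad_form A x `^ (p / 2).
Let v t := u (expR t *: x).
Let dv t := euler (expR t *: x).
Let e t := expR (- (p^-1 * (expR (p * t) * q))).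

Let enorm_ray t : enorm (expR t *: x) `^ s = expR (s * t) * enorm x `^ s.
Proof.
rewrite enormZ (ger0_norm (expR_ge0 _)) powRM ?expR_ge0 ?enorm_ge0//.
by rewrite mulrC [s * t]mulrC expRM mulrC.
Qed.

Let quad_ray t : quad_form A (expR t *: x) `^ (p / 2) = expR (p * t) * q.
Proof.
rewrite quad_formZ powRM ?sqr_ge0//; congr (_ * _).
rewrite -powR_mulrn ?expR_ge0// -powRrM [2%:R * _]mulrC divfK ?gt_eqF//.
by rewrite [p * t]mulrC expRM.
Qed.

Let rho_ray t : rho p c A (expR t *: x) = c * e t.
Proof. by rewrite /rho quad_ray. Qed.

Let expk t : expR (d%:R * t) / expR (s * t) = expR (k * t).
Proof. by rewrite -expRB /k mulrBl. Qed.

Let HE t : H t = K * (expR (k * t) * e t * `|v t| `^ p).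
Proof.
rewrite /H /hardy_lhs enorm_ray rho_ray -expk /K invfM /v; ring.
Qed.

Let dHE t : dH t = K * (expR (k * t) * e t *
  (k * `|v t| `^ p + dabsp p (v t) * dv t - expR (p * t) * q * `|v t| `^ p)).
Proof.
rewrite /dH /hardy_div enorm_ray rho_ray quad_ray -expk /K invfM /v /dv; ring.
Qed.

Let dv_ray (t : R) : is_derive t 1 v (dv t).
Proof.
have D1 (z : R) : is_derive z 1 (fun z : R => u (z *: x + 0)) ('D_x u (z *: x + 0)).
  apply: is_derive_line; have := is_derive_partials (z *: x + 0) x du cdu.
  by case.
have De := is_derive_expR t.
have := @is_derive1_comp _ (fun z : R => u (z *: x + 0)) _ _ _ _ (D1 _) De.
have -> : (fun z : R => u (z *: x + 0)) \o expR = v.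
  by apply/funext => z; rewrite /v /= addr0.
rewrite (_ : _ * _ = dv t)//.
have [_ ->] := is_derive_partials (expR t *: x + 0) x du cdu.
rewrite addr0 /dv /euler mulr_suml; apply: eq_bigr => i _.
by rewrite !mxE; ring.
Qed.

(** Along the ray, |x| and x^t A x are multiples of e^t and e^(2 t), so only the
    factor |u|^p needs the derivatives of u. *)
Lemma is_derive_dilation (t : R) : is_derive t 1 H (dH t).
Proof.
rewrite (funext HE) dHE.
have D1 : is_derive t 1 (fun t : R => expR (k * t)) (expR (k * t) * k).
  have Dl : is_derive t 1 ( *%R k) k.
    by apply: is_derive_eq; rewrite [LHS]mulr1.
  exact: (@is_derive1_comp _ expR _ _ _ _ (is_derive_expR (k * t)) Dl).
have D2 : is_derive t 1 e (e t * (- (p^-1 * (expR (p * t) * p * q)))).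
  have Dl : is_derive t 1 ( *%R p) p.
    by apply: is_derive_eq; rewrite [LHS]mulr1.
  have De := @is_derive1_comp _ expR _ _ _ _ (is_derive_expR (p * t)) Dl.
  have Di : is_derive t 1 (fun t : R => - (p^-1 * (expR (p * t) * q)))
      (- (p^-1 * (expR (p * t) * p * q))).
    have -> : (fun t : R => - (p^-1 * (expR (p * t) * q))) =
        (- (p^-1 * q)) \*: (expR \o *%R p).
      by apply/funext => z /=; rewrite /GRing.scale/=; ring.
    have -> : - (p^-1 * (expR (p * t) * p * q)) = (- (p^-1 * q)) *: (expR (p * t) * p).
      by rewrite /GRing.scale/=; ring.
    exact: is_deriveZ.
  exact: (@is_derive1_comp _ expR _ _ _ _ (is_derive_expR _) Di).
have D3 := @is_derive1_comp _ (fun z : R => `|z| `^ p) _ _ _ _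
  (is_derive_absp (v t) p1) (dv_ray t).
have D := is_deriveZ K (is_deriveM (is_deriveM D1 D2) D3).
have -> : K * (expR (k * t) * e t *
     (k * `|v t| `^ p + dabsp p (v t) * dv t - expR (p * t) * q * `|v t| `^ p)) =
    K *: (((fun t : R => expR (k * t)) * e) t *: (dabsp p (v t) * dv t) +
       ((fun z : R => `|z| `^ p) \o v) t *:
       (expR (k * t) *: (e t * - (p^-1 * (expR (p * t) * p * q))) +
        e t *: (expR (k * t) * k))).
  rewrite /GRing.scale/=.
  have -> : ((fun t : R => expR (k * t)) * e) t = expR (k * t) * e t by [].
  by field; rewrite gt_eqF.
exact: D.
Qed.

Lemma continuous_dilation : continuous dH.
Proof.
have cexp b : continuous (fun t : R => expR (b * t)).
  move=> t; apply: (@continuous_comp _ _ _ ( *%R b) expR).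
    exact: mulrl_continuous.
  exact: continuous_expR.
have cray : continuous (fun t : R => expR t *: x).
  by move=> t; apply: cvgZr_tmp; exact: continuous_expR.
have ccomp (f : 'rV[R]_d -> R) : continuous f -> continuous (fun t : R => f (expR t *: x)).
  move=> cf t; apply: (@continuous_comp _ _ _ (fun t : R => expR t *: x) f).
    exact: cray.
  exact: cf.
have ceul : continuous euler.
  apply: continuous_sumr => i y.
  have cy : (z : 'rV[R]_d) 0 i @[z --> y] --> y 0 i by exact: coord_continuous.
  exact: (cvgM cy (@cdu i y)).
have cv : continuous v by exact: ccomp.
have cvp : continuous (fun t => `|v t| `^ p).
  move=> t; apply: (@continuous_comp _ _ _ v (fun z => `|z| `^ p)); first exact: cv.
  exact: continuous_powR_norm.
have cvd : continuous (fun t => dabsp p (v t)).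
  move=> t; apply: (@continuous_comp _ _ _ v (dabsp p)); first exact: cv.
  exact: continuous_dabsp.
have ce : continuous e.
  move=> t; apply: (@continuous_comp _ _ _ (fun t : R => - (p^-1 * (expR (p * t) * q))) expR).
    by apply: cvgN; apply: cvgMl_tmp; apply: cvgMr_tmp; exact: cexp.
  exact: continuous_expR.
rewrite (funext dHE) => t; apply: cvgMl_tmp; apply: cvgM.
  by apply: cvgM; [exact: cexp|exact: ce].
apply: cvgB.
  apply: cvgD; first by apply: cvgMl_tmp; exact: cvp.
  by apply: cvgM; [exact: cvd|exact: ccomp].
by apply: cvgM; [apply: cvgMr_tmp; exact: cexp|exact: cvp].
Qed.

End along_ray.

Lemma hardy_lhs_ge0 x : 0 <= hardy_lhs x.
Proof.
by apply: mulr_ge0; [rewrite !mulr_ge0 ?invr_ge0 ?powR_ge0|exact: rho_ge0].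
Qed.

Lemma hardy_grad_ge0 x : 0 <= hardy_grad x.
Proof.
by apply: mulr_ge0; [rewrite !mulr_ge0 ?invr_ge0 ?powR_ge0|exact: rho_ge0].
Qed.

Lemma hardy_quad_ge0 x : 0 <= hardy_quad x.
Proof.
by apply: mulr_ge0; [rewrite !mulr_ge0 ?invr_ge0 ?powR_ge0|exact: rho_ge0].
Qed.

Let mpow (f : borel_rV R d -> R) q : measurable_fun setT f ->
  measurable_fun setT (fun x => f x `^ q).
Proof. by move=> mf; exact: (measurableT_comp (measurable_powR q) mf). Qed.

Let mu_ : measurable_fun setT (fun x : borel_rV R d => `|u x| `^ p).
Proof.
by apply: mpow; apply: measurableT_comp => //; exact: continuous_measurable_rV.
Qed.

Let menorm q : measurable_fun setT (fun x : borel_rV R d => (enorm (x : 'rV[R]_d) `^ q)^-1).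
Proof.
rewrite (_ : (fun x => _) = fun x : borel_rV R d => enorm (x : 'rV[R]_d) `^ (- q)); last first.
  by apply/funext => x; rewrite powRN.
by apply: mpow; apply: continuous_measurable_rV; exact: continuous_enorm.
Qed.

Lemma measurable_lhs_integrand : measurable_fun setT
  (fun x : borel_rV R d => `|u x| `^ p / enorm (x : 'rV[R]_d) `^ s).
Proof. by apply: measurable_funM; [exact: mu_|exact: menorm]. Qed.

Lemma measurable_quad_integrand : measurable_fun setT (fun x : borel_rV R d =>
  `|u x| `^ p * quad_form A x `^ (p / 2) / enorm (x : 'rV[R]_d) `^ s).
Proof.
apply: measurable_funM; last exact: menorm.
apply: measurable_funM; first exact: mu_.
by apply: mpow; apply: continuous_measurable_rV; exact: continuous_quad_form.
Qed.

Lemma measurable_grad_integrand : measurable_fun setT (fun x : borel_rV R d =>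
  enorm (gradient u x) `^ p / enorm (x : 'rV[R]_d) `^ (p * a)).
Proof.
apply: measurable_funM; last exact: menorm.
apply: mpow; apply: continuous_measurable_rV => x.
apply: (@continuous_comp _ _ _ (fun x : 'rV[R]_d => \sum_i gradient u x 0 i ^+ 2)
  Num.sqrt); last exact: sqrt_continuous.
apply: continuous_sumr => i {}x.
apply: (@continuous_comp _ _ _ (fun x : 'rV[R]_d => gradient u x 0 i) (fun z => z ^+ 2)).
  rewrite (_ : (fun x => _) = partial i u); first exact: cdu.
  by apply/funext => y; rewrite /gradient mxE.
exact: exprn_continuous.
Qed.

Lemma measurable_hardy_lhs : measurable_fun setT (hardy_lhs : borel_rV R d -> R).
Proof. exact: (measurable_funM measurable_lhs_integrand (measurable_rho p c A)). Qed.

Lemma measurable_hardy_quad : measurable_fun setT (hardy_quad : borel_rV R d -> R).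
Proof. exact: (measurable_funM measurable_quad_integrand (measurable_rho p c A)). Qed.

Lemma measurable_hardy_grad : measurable_fun setT (hardy_grad : borel_rV R d -> R).
Proof. exact: (measurable_funM measurable_grad_integrand (measurable_rho p c A)). Qed.

Hypothesis u0 : u 0 = 0.

Lemma hardy_lhs0 : hardy_lhs 0 = 0.
Proof. by rewrite /hardy_lhs u0 normr0 powR0 ?gt_eqF// !mul0r. Qed.

Lemma hardy_quad0 : hardy_quad 0 = 0.
Proof. by rewrite /hardy_quad u0 normr0 powR0 ?gt_eqF// !mul0r. Qed.

(* The positive and negative parts of sig put each term on the side of the
   inequality where its integrand is nonnegative. *)
Let sp := Num.max sig 0.
Let sm := Num.max (- sig) 0.
Let sp0 : 0 <= sp. Proof. by rewrite le_max lexx orbT. Qed.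
Let sm0 : 0 <= sm. Proof. by rewrite le_max lexx orbT. Qed.
Let spm : sig = sp - sm.
Proof. by rewrite /sp /sm; case: (leP sig 0); case: (leP (- sig) 0); lra. Qed.

Let P x := kap `^ p * hardy_lhs x + sm * hardy_quad x.
Let N x := hardy_grad x + sp * hardy_quad x.
Let H0 x := hardy_lhs x.
Let H1 x := expR d%:R * hardy_lhs (expR 1 *: x).

Let P0 x : 0 <= P x.
Proof.
apply: addr_ge0; apply: mulr_ge0; rewrite ?powR_ge0//.
  exact: hardy_lhs_ge0.
exact: hardy_quad_ge0.
Qed.
Let N0 x : 0 <= N x.
Proof.
apply: addr_ge0; first exact: hardy_grad_ge0.
by apply: mulr_ge0 => //; exact: hardy_quad_ge0.
Qed.
Let mP : measurable_fun setT (P : borel_rV R d -> R).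
Proof.
apply: measurable_funD; apply: measurable_funM => //.
  exact: measurable_hardy_lhs.
exact: measurable_hardy_quad.
Qed.
Let mN : measurable_fun setT (N : borel_rV R d -> R).
Proof.
apply: measurable_funD; first exact: measurable_hardy_grad.
by apply: measurable_funM => //; exact: measurable_hardy_quad.
Qed.

Let mline (f : borel_rV R d -> R) (x : 'rV[R]_d) : measurable_fun setT f ->
  measurable_fun setT (fun t : R => expR (d%:R * t) * f (expR t *: x)).
Proof.
move=> mf; apply: measurable_funM.
  by apply: measurableT_comp => //; apply: measurable_funM.
have mz := measurableT_comp mf (@measurable_dilation R d).
have m2 : measurable_fun setT
    (fun t : measurableTypeR R => (t, x : borel_rV R d)).
  exact: pair2_measurable.
exact: (measurableT_comp mz m2).
Qed.

(** The pointwise estimate integrated over t in [0, 1], the boundary terms being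
    moved to the side where they are nonnegative. *)
Lemma hardy_ray x :
  (\int[lebesgue_measure]_(t in `[0%R, 1%R])
      (expR (d%:R * t) * P (expR t *: x))%:E + (sp * H0 x + sm * H1 x)%:E <=
   \int[lebesgue_measure]_(t in `[0%R, 1%R])
      (expR (d%:R * t) * N (expR t *: x))%:E + (sp * H1 x + sm * H0 x)%:E)%E.
Proof.
have aux (e l g q D b s1 s2 s' : R) : 0 <= e -> s' = s1 - s2 ->
    b * l <= g + s' * q + s' * D ->
    e * (b * l + s2 * q) <= e * (g + s1 * q) + s' * (e * D).
  move=> e0 -> H; rewrite -subr_ge0 [leRHS](_ : _ =
    e * (g + (s1 - s2) * q + (s1 - s2) * D - b * l)); last by ring.
  by rewrite mulr_ge0// subr_ge0.
have [->|x0] := eqVneq x 0.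
  rewrite /H0 /H1 scaler0 hardy_lhs0 !mulr0 addr0 !adde0.
  apply: ge0_le_integral => //.
  - by move=> t _; rewrite lee_fin mulr_ge0 ?expR_ge0.
  - by apply/measurable_EFinP/measurable_funTS; exact: (mline 0 mP).
  - by apply/measurable_EFinP/measurable_funTS; exact: (mline 0 mN).
  - move=> t _; rewrite lee_fin scaler0 ler_wpM2l ?expR_ge0//.
    by rewrite /P hardy_lhs0 hardy_quad0 !mulr0 addr0.
pose F t := sig * (expR (d%:R * t) * hardy_lhs (expR t *: x)).
pose f t := sig * (expR (d%:R * t) * hardy_div (expR t *: x)).
have dF (t : R) : is_derive t 1 F (f t).
  exact: (is_deriveZ sig (is_derive_dilation x t)).
have cf : continuous f.
  have cd := @continuous_dilation x.
  move=> t; exact: (cvgM (cvg_cst sig) (cd t)).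
have := @ge0_le_integral_FTC R (fun t => expR (d%:R * t) * P (expR t *: x))
  (fun t => expR (d%:R * t) * N (expR t *: x)) F f (mline x mP) (mline x mN).
move=> /(_ _ _ dF cf) H.
have {H} : (\int[lebesgue_measure]_(t in `[0%R, 1%R])
      (expR (d%:R * t) * P (expR t *: x))%:E + (F 0)%:E <=
   \int[lebesgue_measure]_(t in `[0%R, 1%R])
      (expR (d%:R * t) * N (expR t *: x))%:E + (F 1)%:E)%E.
  apply: H => t; rewrite ?mulr_ge0 ?expR_ge0//.
  have tx0 : expR t *: x != 0 by rewrite scaler_eq0 negb_or gt_eqF ?expR_gt0.
  exact: (aux _ _ _ _ _ _ _ _ _ (expR_ge0 (d%:R * t)) spm (hardy_pointwise tx0)).
have aux2 (X Y : \bar R) (r1 r2 m r1' r2' : R) : (X + r1%:E <= Y + r2%:E)%E ->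
    r1' = r1 + m -> r2' = r2 + m -> (X + r1'%:E <= Y + r2'%:E)%E.
  by move=> XY -> ->; rewrite !EFinD !addeA; exact: leeD2r.
move=> /aux2; apply; first last.
- by rewrite /F spm mulr1 -/(H1 x); instantiate (1 := sm * (H0 x + H1 x)); ring.
- by rewrite /F spm mulr0 expR0 scale1r mul1r -/(H0 x); ring.
Qed.

(** The boundary terms H0 and H1 are h and its dilation, which have the same
    integral. *)
Lemma hardy_integrated :
  (\int[lebesgue_rV R d]_x (hardy_lhs x)%:E < +oo)%E ->
  (\int[lebesgue_rV R d]_x (P x)%:E <= \int[lebesgue_rV R d]_x (N x)%:E)%E.
Proof.
set J := (\int[lebesgue_rV R d]_x (hardy_lhs x)%:E)%E => Jfin.
have mH0 : measurable_fun setT (H0 : borel_rV R d -> R) := measurable_hardy_lhs.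
have mH1 : measurable_fun setT (H1 : borel_rV R d -> R).
  apply: measurable_funM; first exact: measurable_cst.
  exact: (measurableT_comp measurable_hardy_lhs (@measurable_scale_rV R d (expR 1))).
have H00 x : 0 <= H0 x by exact: hardy_lhs_ge0.
have H10 x : 0 <= H1 x by rewrite mulr_ge0 ?expR_ge0 ?hardy_lhs_ge0.
have IH1 : (\int[lebesgue_rV R d]_x (H1 x)%:E)%E = J.
  have mH1' := measurableT_comp measurable_hardy_lhs (@measurable_scale_rV R d (expR 1)).
  have mHe : measurable_fun setT (EFin \o (hardy_lhs : borel_rV R d -> R)).
    by apply/measurable_EFinP; exact: measurable_hardy_lhs.
  have He0 x : (0 <= (EFin \o hardy_lhs) x)%E by rewrite lee_fin hardy_lhs_ge0.
  have HZ := ge0_integralZ_lebesgue_rV (expR_gt0 1) mHe He0.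
  rewrite (ge0_integralZ_EFin _ (expR_ge0 d%:R) mH1' (fun x => hardy_lhs_ge0 _)).
  rewrite [X in (_ * X)%E]HZ muleA -EFinM -[d%:R]mulr1 expRM_natl.
  rewrite mulfV ?mul1e// expf_neq0// gt_eqF// expR_gt0//.
have comb := @ge0_integral_lincomb _ _ _ (lebesgue_rV R d).
have IS1 : (\int[lebesgue_rV R d]_x (sp * H0 x + sm * H1 x)%:E =
    sp%:E * J + sm%:E * J)%E.
  by rewrite (comb _ _ _ _ sp0 sm0 mH0 mH1 H00 H10) IH1.
have IS2 : (\int[lebesgue_rV R d]_x (sp * H1 x + sm * H0 x)%:E =
    sp%:E * J + sm%:E * J)%E.
  by rewrite (comb _ _ _ _ sp0 sm0 mH1 mH0 H10 H00) IH1.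
have S10 (x : borel_rV R d) : (0 <= (sp * H0 x + sm * H1 x)%:E)%E.
  by rewrite lee_fin addr_ge0// mulr_ge0.
have S20 (x : borel_rV R d) : (0 <= (sp * H1 x + sm * H0 x)%:E)%E.
  by rewrite lee_fin addr_ge0// mulr_ge0.
have mS1 : measurable_fun setT
    (fun x : borel_rV R d => (sp * H0 x + sm * H1 x)%:E).
  by apply/measurable_EFinP/measurable_funD; apply: measurable_funM.
have mS2 : measurable_fun setT
    (fun x : borel_rV R d => (sp * H1 x + sm * H0 x)%:E).
  by apply/measurable_EFinP/measurable_funD; apply: measurable_funM.
rewrite -(integral_dilation_average mP P0) -(integral_dilation_average mN N0).
apply: (ge0_le_integral_cancel (measurable_dilation_average mP P0)
  (measurable_dilation_average mN N0) mS1 mS2 _ _ S10 S20 hardy_ray).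
- move=> x; apply: integral_ge0 => t _.
  by rewrite lee_fin mulr_ge0 ?expR_ge0.
- move=> x; apply: integral_ge0 => t _.
  by rewrite lee_fin mulr_ge0 ?expR_ge0.
- by rewrite [LHS]IS1 [RHS]IS2.
- rewrite [ltLHS]IS1; apply: lte_add_pinfty; apply: lte_mul_pinfty => //.
Qed.

End hardy.

(** * The domain *)

Section omega.
Context (R : realType) (d : nat).

Lemma measurable_Omega : measurable (Omega R d : set (borel_rV R d)).
Proof.
rewrite /Omega; case: ifP => _; last exact: measurableT.
pose B : set (borel_rV R d) := \bigcap_(i : 'I_d)
  ((fun x : borel_rV R d => (x : 'rV[R]_d) 0 i) @^-1` [set r : R | 0 < r]).
have BE : [set x : 'rV[R]_d | forall i, 0 < x 0 i] = B.
  by apply/seteqP; split=> [x xi i _|x xi i] /=; [exact: xi|exact: xi].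
suff mB : measurable B.
  exact: (eq_ind_r (fun S : set (borel_rV R d) => measurable S) mB BE).
apply: fin_bigcap_measurable => // i _.
rewrite -[X in measurable X]setTI; apply: continuous_measurable_rV => //.
  exact: coord_continuous.
by apply: open_measurable; exact: open_gt.
Qed.

Lemma Omega0_Omega : Omega0 R d `<=` Omega R d.
Proof. by rewrite /Omega0 /Omega; case: ifP => _ x. Qed.

(** In Omega0 the condition x != 0 is read on the function of the two indices
    that underlies the matrix x. *)
Lemma Omega0P (x : 'rV[R]_d) : d != 1%N -> Omega0 R d x <-> x != 0.
Proof.
rewrite /Omega0 => /negbTE ->; split => /= x0.
- apply/eqP => xE; move/eqP: x0; apply; rewrite xE.
  by apply/funext => i; apply/funext => j; rewrite mxE.
- apply/eqP => xE; move/eqP: x0; apply; apply/matrixP => i j.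
  by rewrite mxE -[LHS]/((x : 'I_1 -> 'I_d -> R) i j) xE.
Qed.

Lemma Omega0_neq0 (x : 'rV[R]_d) : (0 < d)%N -> Omega0 R d x -> x != 0.
Proof.
move=> d0; have [d1|d1] := eqVneq d 1%N; last by move=> /(Omega0P _ d1).
rewrite /Omega0 ifT ?d1// => xp; apply/eqP => x0.
by have := xp (Ordinal d0); rewrite x0 mxE ltxx.
Qed.

Lemma integral_Omega_T (g : borel_rV R d -> R) :
  (forall x, ~ Omega R d x -> g x = 0) ->
  (\int[lebesgue_rV R d]_(x in Omega R d) (g x)%:E =
   \int[lebesgue_rV R d]_x (g x)%:E)%E.
Proof.
move=> g0; rewrite integral_mkcond; apply: eq_integral => x _.
rewrite patchE; case: ifPn => // xO; rewrite g0// => xO'.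
by move/negP: xO; apply; rewrite inE.
Qed.

Lemma integral_rho_measure (p c : R) (A : 'M[R]_d) (c0 : 0 < c)
    (f : borel_rV R d -> R) (D : set (borel_rV R d)) :
  measurable D -> measurable_fun setT f -> (forall x, 0 <= f x) ->
  (\int[rho_measure p A c0]_(x in D) (f x)%:E =
   \int[lebesgue_rV R d]_(x in D) (f x * rho p c A x)%:E)%E.
Proof.
move=> mD mf f0.
have mfD : measurable_fun D (EFin \o f).
  by apply/measurable_EFinP/measurable_funTS.
exact: (@ge0_integral_density _ _ _ (lebesgue_rV R d)
  [the measure _ _ of rho_measure p A c0] _ (rho_ge0 p A c0) (measurable_rho p c A)
  (fun V _ => erefl) (EFin \o f) D (fun x => f0 x) mD mfD).
Qed.

Lemma gradient_off_support (u : 'rV[R]_d -> R) x : ~ Defs.support u x ->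
  u x = 0 /\ gradient u x = 0.
Proof.
move=> xu.
have nu : \near x, u x = cst 0 x.
  have : open (~` Defs.support u) by rewrite openC; exact: closed_closure.
  rewrite openE => /(_ _ xu); apply: filterS => y /= yu.
  by apply/eqP; apply: contra_notT yu => uy; exact: subset_closure.
split; first exact: (nbhs_singleton nu).
apply/rowP => i; rewrite !mxE /partial (near_eq_derive _ nu).
exact: derive_cst.
Qed.

End omega.

(** * The weighted inequality for test functions *)

Section weighted_inequality.
Context (R : realType) (d : nat) (p c a : R) (A : 'M[R]_d).
Hypotheses (d1 : (1 <= d)%N) (p1 : 1 < p) (c0 : 0 < c) (Apsd : pos_semidef A).

Lemma hardy_inequalityE (lam : R) (u : 'rV[R]_d -> R) :
  (forall i, continuous (partial i u)) -> continuous u ->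
  hardy_inequality p a A c0 lam u =
  (lam%:E * \int[lebesgue_rV R d]_(x in Omega R d) (hardy_lhs p c a A u x)%:E
   <= \int[lebesgue_rV R d]_(x in Omega R d) (hardy_grad p c a A u x)%:E
      + ((`|d%:R - p * (a + 1)| / p) `^ (p - 1) * Num.sg (d%:R - p * (a + 1)))%:E
        * \int[lebesgue_rV R d]_(x in Omega R d) (hardy_quad p c a A u x)%:E)%E.
Proof.
move=> cdu cu; have mO := @measurable_Omega R d.
rewrite /hardy_inequality.
rewrite (integral_rho_measure p A c0 mO (measurable_lhs_integrand p a cu)); last first.
  by move=> x; rewrite mulr_ge0 ?invr_ge0 ?powR_ge0.
rewrite (integral_rho_measure p A c0 mO (measurable_grad_integrand p a cdu)); last first.
  by move=> x; rewrite mulr_ge0 ?invr_ge0 ?powR_ge0.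
rewrite (integral_rho_measure p A c0 mO (measurable_quad_integrand p a A cu))//.
by move=> x; rewrite !mulr_ge0 ?invr_ge0 ?powR_ge0.
Qed.

Lemma continuous_quad_powR : continuous (fun x => quad_form A x `^ (p / 2)).
Proof.
have -> : (fun x => quad_form A x `^ (p / 2)) =
    (fun z : R => `|z| `^ (p / 2)) \o (quad_form A).
  by apply/funext => y /=; rewrite ger0_norm.
have p20 : 0 < p / 2 by rewrite divr_gt0// (lt_trans _ p1).
move=> x; apply: continuous_comp; first exact: continuous_quad_form.
exact: (continuous_powR_norm p20).
Qed.

Lemma continuous_rho : continuous (rho p c A).
Proof.
have cI : continuous (fun r : R => - (p^-1 * r)).
  by move=> r; apply: cvgN; apply: cvgMl_tmp; exact: cvg_id.
have cJ : continuous (fun r : R => c * expR (- (p^-1 * r))).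
  move=> r; apply: cvgMl_tmp.
  exact: (cvg_comp _ _ (cI r) (@continuous_expR R _)).
move=> x; apply: (@continuous_comp _ _ _ (fun x => quad_form A x `^ (p / 2)) _ x _ (cJ _)).
exact: continuous_quad_powR.
Qed.

Lemma continuous_at_hardy_lhs (u : 'rV[R]_d -> R) (x : 'rV[R]_d) : continuous u -> x != 0 ->
  {for x, continuous (hardy_lhs p c a A u)}.
Proof.
move=> cu x0; have p0 : 0 < p by exact: lt_trans p1.
have c1 : `|u z| `^ p @[z --> x] --> `|u x| `^ p.
  apply: (@continuous_comp _ _ _ u (fun z : R => `|z| `^ p)); first exact: cu.
  exact: (continuous_powR_norm p0).
have c2 : (enorm z `^ (p * (a + 1)))^-1 @[z --> x] --> (enorm x `^ (p * (a + 1)))^-1.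
  have E : (fun z : 'rV[R]_d => (enorm z `^ (p * (a + 1)))^-1) =
      (fun z : R => z `^ (- (p * (a + 1)))) \o (@enorm R d).
    by apply/funext => y; rewrite /= powRN.
  have : {for x, continuous ((fun z : R => z `^ (- (p * (a + 1)))) \o (@enorm R d))}.
    apply: continuous_comp; first exact: continuous_enorm.
    apply/differentiable_continuous/derivable1_diffP.
    by have [] := is_derive1_powR (- (p * (a + 1))) (enorm_gt0 x0).
  by rewrite -E.
have c3 : rho p c A z @[z --> x] --> rho p c A x by exact: continuous_rho.
exact: (cvgM (cvgM c1 c2) c3).
Qed.

Lemma hardy_quadE (u : 'rV[R]_d -> R) x : hardy_quad p c a A u x =
  quad_form A x `^ (p / 2) * hardy_lhs p c a A u x.
Proof. rewrite /hardy_quad /hardy_lhs; ring. Qed.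

Lemma continuous_at_hardy_quad (u : 'rV[R]_d -> R) (x : 'rV[R]_d) : continuous u -> x != 0 ->
  {for x, continuous (hardy_quad p c a A u)}.
Proof.
move=> cu x0; rewrite (funext (hardy_quadE u)).
have c1 : quad_form A z `^ (p / 2) @[z --> x] --> quad_form A x `^ (p / 2).
  exact: continuous_quad_powR.
have c2 : hardy_lhs p c a A u z @[z --> x] --> hardy_lhs p c a A u x.
  exact: continuous_at_hardy_lhs.
exact: (cvgM c1 c2).
Qed.

Lemma weighted_hardy (u : 'rV[R]_d -> R) : Cc_infty0 u ->
  hardy_inequality p a A c0 ((`|d%:R - p * (a + 1)| / p) `^ p) u.
Proof.
move=> [smu cK KO].
have cu : continuous u by have [] := smu [::].
have du i x : derivable u x (delta_mx 0 i) by have [_] := smu [::].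
have cdu i : continuous (partial i u) by have [] := smu [:: i].
have off x : ~ Defs.support u x -> u x = 0 /\ gradient u x = 0.
  exact: gradient_off_support.
have p0 : 0 < p by exact: lt_trans p1.
have K0 x : Defs.support u x -> x != 0 by move=> /KO /(Omega0_neq0 d1).
have u0 : u 0 = 0.
  by have [] // := off 0; move=> /K0; rewrite eqxx.
rewrite hardy_inequalityE//.
have toT f : (forall x, ~ Defs.support u x -> f x = 0) ->
    (\int[lebesgue_rV R d]_(x in Omega R d) (f x)%:E =
     \int[lebesgue_rV R d]_x (f x)%:E)%E.
  move=> f0; apply: integral_Omega_T => x xO; apply: f0 => xu; apply: xO.
  exact: (Omega0_Omega (KO _ xu)).
have lhs_off x : ~ Defs.support u x -> hardy_lhs p c a A u x = 0.
  by move=> /off[ux _]; rewrite /hardy_lhs ux normr0 powR0 ?gt_eqF// !mul0r.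
have quad_off x : ~ Defs.support u x -> hardy_quad p c a A u x = 0.
  by move=> /off[ux _]; rewrite /hardy_quad ux normr0 powR0 ?gt_eqF// !mul0r.
have grad_off x : ~ Defs.support u x -> hardy_grad p c a A u x = 0.
  by move=> /off[_ gx]; rewrite /hardy_grad gx enorm0 powR0 ?gt_eqF// !mul0r.
rewrite (toT _ lhs_off) (toT _ quad_off) (toT _ grad_off).
have mL := measurable_hardy_lhs p c a A cu.
have mQ := measurable_hardy_quad p c a A cu.
have mG := measurable_hardy_grad p c a A cdu.
have L0 := hardy_lhs_ge0 p a A c0 u.
have Q0 := hardy_quad_ge0 p a A c0 u.
have G0 := hardy_grad_ge0 p a A c0 u.
have fL : (\int[lebesgue_rV R d]_x (hardy_lhs p c a A u x)%:E < +oo)%E.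
  apply: (integral_compact_lty cK mL L0 lhs_off) => x Kx.
  by apply: continuous_at_hardy_lhs => //; exact: K0.
have fQ : (\int[lebesgue_rV R d]_x (hardy_quad p c a A u x)%:E < +oo)%E.
  apply: (integral_compact_lty cK mQ Q0 quad_off) => x Kx.
  by apply: continuous_at_hardy_quad => //; exact: K0.
have HI := hardy_integrated p1 c0 Apsd du cu cdu u0 fL.
set k := d%:R - p * (a + 1); set kap := `|k| / p.
set sig := kap `^ (p - 1) * Num.sg k.
have kp0 : 0 <= kap `^ p by exact: powR_ge0.
have sm0 : 0 <= Num.max (- sig) 0 by rewrite le_max lexx orbT.
have sp0 : 0 <= Num.max sig 0 by rewrite le_max lexx orbT.
have : (\int[lebesgue_rV R d]_x (kap `^ p * hardy_lhs p c a A u x +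
      Num.max (- sig) 0 * hardy_quad p c a A u x)%:E <=
    \int[lebesgue_rV R d]_x (hardy_grad p c a A u x +
      Num.max sig 0 * hardy_quad p c a A u x)%:E)%E by exact: HI.
rewrite (ge0_integral_lincomb _ kp0 sm0 mL mQ L0 Q0).
have e1 x : hardy_grad p c a A u x + Num.max sig 0 * hardy_quad p c a A u x =
  1 * hardy_grad p c a A u x + Num.max sig 0 * hardy_quad p c a A u x.
  by rewrite mul1r.
under [X in (_ <= X)%E]eq_integral do rewrite e1.
rewrite (ge0_integral_lincomb _ ler01 sp0 mG mQ G0 Q0) mul1e.
set IL := (\int[lebesgue_rV R d]_x (hardy_lhs p c a A u x)%:E)%E in fL *.
set IQ := (\int[lebesgue_rV R d]_x (hardy_quad p c a A u x)%:E)%E in fQ *.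
set IG := (\int[lebesgue_rV R d]_x (hardy_grad p c a A u x)%:E)%E.
have IQ0 : (0 <= IQ)%E by apply: integral_ge0 => x _; rewrite lee_fin.
(* For sig < 0 the last integral is subtracted, which requires it to be
   finite. *)
have /orP[s0|/ltW s0] : (0 <= sig) || (sig < 0) by case: (ltP sig 0); rewrite ?orbT.
  have -> : Num.max sig 0 = sig by exact/max_idPl.
  have -> : Num.max (- sig) 0 = 0 by apply/max_idPr; rewrite oppr_le0.
  by rewrite mul0e adde0.
have -> : Num.max sig 0 = 0 by exact/max_idPr.
have -> : Num.max (- sig) 0 = - sig by apply/max_idPl; rewrite oppr_ge0.
rewrite mul0e adde0 => H.
have fin : ((- sig)%:E * IQ)%E \is a fin_num by rewrite fin_numM// ge0_fin_numE.
rewrite -leeBrDr// in H.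
by rewrite (le_trans H)// EFinN mulNe oppeK.
Qed.

End weighted_inequality.

(** * Smooth functions of one variable *)

Section smooth1d.
Context (R : realType).

(** The family z^(-n) e^(-1/z), extended by 0, is stable under differentiation up
    to linear combinations. *)
Definition expV (n : nat) (z : R) := if 0 < z then z ^- n * expR (- z^-1) else 0.

(** A class of functions closed under differentiation.  The last constructor
    allows real powers, which are not smooth at 0, in front of functions that
    vanish near the half-line z <= 0. *)
Inductive smooth1 : (R -> R) -> Prop :=
| smooth1_cst c : smooth1 (fun=> c)
| smooth1_id : smooth1 id
| smooth1_add f g : smooth1 f -> smooth1 g -> smooth1 (fun z => f z + g z)
| smooth1_mul f g : smooth1 f -> smooth1 g -> smooth1 (fun z => f z * g z)
| smooth1_comp f g : smooth1 f -> smooth1 g -> smooth1 (fun z => f (g z))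
| smooth1_expV n : smooth1 (expV n)
| smooth1_powR b eta f : 0 < eta -> (forall z, z < eta -> f z = 0) ->
    smooth1 f -> smooth1 (fun z => z `^ b * f z).

Lemma expV_le0 n z : z <= 0 -> expV n z = 0.
Proof. by rewrite /expV ltNge => ->. Qed.

Lemma expV_ge0 n z : 0 <= expV n z.
Proof.
rewrite /expV; case: ifPn => // z0.
by rewrite mulr_ge0 ?expR_ge0// invr_ge0 exprn_ge0// ltW.
Qed.

(** From the term of degree n + 2 in the exponential series at 1 / z. *)
Lemma expV_le n (z : R) : 0 <= z -> expV n z <= (n.+2)`!%:R * z ^+ 2.
Proof.
rewrite le_eqVlt => /predU1P[<-|z0]; first by rewrite expV_le0// mulr_ge0// ?sqr_ge0// ler0n.
rewrite /expV z0 expRN.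
have zi0 : 0 <= z^-1 by rewrite invr_ge0 ltW.
have H := expR_ge1Dxn n.+1 zi0.
have H2 : z^-1 ^+ n.+2 / (n.+2)`!%:R <= expR z^-1 by apply: le_trans H; rewrite lerDr.
have f0 : 0 < (n.+2)`!%:R :> R by rewrite ltr0n fact_gt0.
rewrite ler_pdivrMr ?expR_gt0//.
have -> : z ^- n = (n.+2)`!%:R * z ^+ 2 * (z^-1 ^+ n.+2 / (n.+2)`!%:R).
  by rewrite -addn2 exprD exprVn; field; rewrite !gt_eqF ?exprn_gt0// addn2 gt_eqF.
by rewrite ler_wpM2l// mulr_ge0 ?sqr_ge0// ltW.
Qed.

(** At 0 the difference quotient is O(h) by the flatness of expV. *)
Lemma is_derive_expV n (z : R) :
  is_derive z 1 (expV n) (- n%:R * expV n.+1 z + expV n.+2 z).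
Proof.
have [z0|z0|->] := ltgtP z 0.
- rewrite !expV_le0 ?(ltW z0)// mulr0 addr0.
  apply: (@near_eq_is_derive R R R (cst 0)).
  by near=> y; rewrite expV_le0// ltW//; near: y; exact: lt_nbhsl.
- have zn0 : z != 0 by rewrite gt_eqF.
  apply: (@near_eq_is_derive R R R (fun y => y ^- n * expR (- y^-1))).
    by near=> y; rewrite /expV ifT//; near: y; exact: lt_nbhsr.
  have Di : is_derive z 1 (fun y : R => y^-1) (- z ^- 2).
    have := is_deriveV zn0 (is_derive_id z (1 : R)).
    by rewrite /GRing.scale/= mulr1.
  have DN : is_derive z 1 (fun y : R => - y^-1) (z ^- 2).
    by rewrite -[z ^- 2]opprK; exact: is_deriveN.
  have De := @is_derive1_comp _ expR (fun y : R => - y^-1) _ _ _ (is_derive_expR (- z^-1)) DN.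
  have Dn := is_deriveX n Di.
  have := is_deriveM Dn De.
  rewrite /expV z0 /GRing.scale/=.
  have -> : ((fun y : R => y^-1) ^+ n * (expR \o (fun y : R => - y^-1))) =
      (fun y => y ^- n * expR (- y^-1)).
    apply/funext => y; rewrite -exprVn -[LHS]/(((fun y : R => y^-1) ^+ n) y * _).
    by rewrite fctE.
  set w := (X in is_derive _ _ _ X).
  move=> H; rewrite (_ : _ + _ = w)//.
  rewrite /w fctE; case: n {Dn w H} => [|n].
    by rewrite !expr0; field.
  by rewrite -!exprVn/= !exprS; field.
- rewrite !expV_le0// mulr0 addr0.
  have H : h^-1 *: ((expV n \o shift 0) (h *: 1) - expV n 0) @[h --> (0:R)^'] --> (0 : R).
    apply: (@norm_le_cvg0 _ _ _ _ _ (fun h => (n.+2)`!%:R * `|h|)).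
      near=> h.
      have h0 : h != 0 by near: h; exact: nbhs_dnbhs_neq.
      rewrite /= addr0 /GRing.scale/= mulr1 (@expV_le0 _ 0)// subr0.
      have [hp|hn] := ltP 0 h; last by rewrite expV_le0// mulr0 normr0 mulr_ge0.
      rewrite normrM normfV (gtr0_norm hp) ger0_norm ?expV_ge0//.
      rewrite mulrC ler_pdivrMr// -mulrA -expr2.
      by apply: expV_le; exact: ltW.
    have Hn : `|h| @[h --> (0:R)^'] --> (0:R).
      have : `|h| @[h --> (0:R)] --> `|0:R| by exact: (@norm_continuous R R).
      by rewrite normr0 => Hn; exact: cvg_within_filter.
    have Hm : (n.+2)`!%:R * `|h| @[h --> (0:R)^'] --> (n.+2)`!%:R * (0:R).
      exact: (cvgM (cvg_cst _) Hn).
    rewrite -[X in _ --> X](mulr0 (n.+2)`!%:R). exact: Hm.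
  split; first by apply/cvg_ex; eexists; exact: H.
  exact/cvg_lim.
Unshelve. all: by end_near. Qed.

Lemma smooth1_derive f : smooth1 f ->
  exists2 f', smooth1 f' & forall z : R, is_derive z 1 f (f' z).
Proof.
elim=> {f} [c||f g sf [f' sf' df] sg [g' sg' dg]|f g sf [f' sf' df] sg [g' sg' dg]
  |f g sf [f' sf' df] sg [g' sg' dg]|n|b eta f eta0 f0 sf [f' sf' df]].
- by exists (fun=> 0); [exact: smooth1_cst|move=> z; exact: is_derive_cst].
- by exists (fun=> 1); [exact: smooth1_cst|move=> z; exact: is_derive_id].
- exists (fun z => f' z + g' z); first exact: smooth1_add.
  by move=> z; exact: is_deriveD.
- exists (fun z => f z * g' z + g z * f' z).
    by apply: smooth1_add; apply: smooth1_mul.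
  by move=> z; exact: is_deriveM.
- exists (fun z => f' (g z) * g' z).
    by apply: smooth1_mul => //; apply: smooth1_comp.
  by move=> z; exact: (@is_derive1_comp _ f g).
- exists (fun z => - n%:R * expV n.+1 z + expV n.+2 z).
    apply: smooth1_add; last exact: smooth1_expV.
    by apply: smooth1_mul; [exact: smooth1_cst|exact: smooth1_expV].
  by move=> z; exact: is_derive_expV.
- have f'0 z : z < eta -> f' z = 0.
    move=> ze; have [_ <-] := df z.
    rewrite (@near_eq_derive _ _ _ _ (cst 0)) ?derive_cst//.
    by near=> y; rewrite f0//; near: y; exact: lt_nbhsl.
  exists (fun z => z `^ (b - 1) * (b * f z) + z `^ b * f' z).
    apply: smooth1_add; last exact: (@smooth1_powR _ eta).
    apply: (@smooth1_powR _ eta) => //; first by move=> z /f0 ->; rewrite mulr0.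
    by apply: smooth1_mul => //; exact: smooth1_cst.
  move=> z; have [ze|ze] := ltP z eta.
    rewrite f0// f'0// !mulr0 addr0.
    apply: (@near_eq_is_derive R R R (cst 0)).
    by near=> y; rewrite f0 ?mulr0//; near: y; exact: lt_nbhsl.
  have z0 : 0 < z by exact: lt_le_trans ze.
  have := is_deriveM (is_derive1_powR b z0) (df z).
  rewrite /GRing.scale/= => H.
  rewrite (_ : _ + _ = z `^ b * f' z + f z * (b * z `^ (b - 1)))//; ring.
Unshelve. all: by end_near. Qed.

End smooth1d.

Section step.
Context (R : realType).

Lemma smooth1_continuous (f : R -> R) : smooth1 f -> continuous f.
Proof.
move=> /smooth1_derive[f' _ df] z.
by apply/differentiable_continuous/derivable1_diffP; have [] := df z.
Qed.

(** With g (z) = e^(-1/z) for z > 0, this is 1 - e g (1 - e^2 g (z)).  The inner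
    function is 1 for z <= 0, where the result is 1 - e g (1) = 0, and it is
    nonpositive for z >= 1/2, where the result is 1.  This avoids a normalizing
    division or integral. *)
Definition step (z : R) :=
  1 - expR 1 * expV 0 (1 - expR 2 * expV 0 z).

Lemma smooth1_step : smooth1 step.
Proof.
have sB (f : R -> R) b : smooth1 f -> smooth1 (fun z => 1 - b * f z).
  move=> sf; have -> : (fun z => 1 - b * f z) = (fun z => 1 + (- b) * f z).
    by apply/funext => z; rewrite mulNr.
  by apply: smooth1_add; [exact: smooth1_cst|];
    apply: smooth1_mul; [exact: smooth1_cst|].
apply: (sB (fun z => expV 0 (1 - expR 2 * expV 0 z))).
apply: (@smooth1_comp _ (expV 0) (fun z => 1 - expR 2 * expV 0 z)).
  exact: smooth1_expV.
by apply: sB; exact: smooth1_expV.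
Qed.

Lemma step_le0 z : z <= 0 -> step z = 0.
Proof.
move=> z0; rewrite /step (expV_le0 _ z0) mulr0 subr0 /expV ltr01.
by rewrite expr0 invr1 mul1r expRN divff ?subrr// gt_eqF ?expR_gt0.
Qed.

Lemma step_ge_half z : 2^-1 <= z -> step z = 1.
Proof.
move=> z2; have z0 : 0 < z by apply: lt_le_trans z2; rewrite invr_gt0.
rewrite /step (@expV_le0 _ _ (1 - _)) ?mulr0 ?subr0//.
rewrite subr_le0 /expV z0 expr0 invr1 mul1r -expRD -[leLHS]expR0 ler_expR.
by rewrite subr_ge0 -(invrK 2) lef_pV2// posrE invr_gt0.
Qed.

Lemma step_itv z : 0 <= step z <= 1.
Proof.
rewrite /step; set w := 1 - expR 2 * _.
have w_le1 : w <= 1 by rewrite gerBl mulr_ge0 ?expR_ge0 ?expV_ge0.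
rewrite gerBl mulr_ge0 ?expR_ge0 ?expV_ge0// andbT subr_ge0 /expV.
case: ifPn => [w0|_]; last by rewrite mulr0.
rewrite expr0 invr1 mul1r -expRD -[leRHS]expR0 ler_expR subr_le0.
by rewrite invf_ge1.
Qed.

Definition dstep (z : R) : R := 'D_1 step z.

Lemma is_derive_step (z : R) : is_derive z 1 step (dstep z).
Proof.
have [f _ df] := smooth1_derive smooth1_step.
by apply: derivableP; have [] := df z.
Qed.

Lemma continuous_dstep : continuous dstep.
Proof.
have [f sf df] := smooth1_derive smooth1_step.
rewrite (_ : dstep = f); first exact: smooth1_continuous.
by apply/funext => z; rewrite /dstep; have [_ ->] := df z.
Qed.

(** Local constancy gives the case z < 0, and continuity of the derivative gives
    z = 0. *)
Lemma dstep_le0 z : z <= 0 -> dstep z = 0.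
Proof.
have fl y : y < 0 -> dstep y = 0.
  move=> y0; rewrite /dstep (@near_eq_derive _ _ _ _ (cst 0)) ?derive_cst//.
  by near=> x; rewrite step_le0// ltW//; near: x; exact: lt_nbhsl.
rewrite le_eqVlt => /predU1P[->|/fl//].
apply/eqP; apply/negPn/negP => fn0.
have n0 : 0 < `|dstep 0| by rewrite normr_gt0.
have /cvgrPdist_lt /(_ _ n0) := @continuous_dstep 0.
move=> /nbhs_ballP[e /= e0 /(_ (- (e / 2)))].
have fe : dstep (- (e / 2)) = 0 by apply: fl; rewrite oppr_lt0 divr_gt0.
rewrite fe subr0 ltxx => H; apply: notF; apply: H.
rewrite /ball/= sub0r opprK gtr0_norm ?divr_gt0//.
by rewrite gtr_pMr// invf_lt1// ltr1n.
Unshelve. all: by end_near. Qed.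

Lemma dstep_ge1 z : 1 <= z -> dstep z = 0.
Proof.
move=> z1; have z2 : 2^-1 < z.
  by apply: lt_le_trans z1; rewrite invf_lt1// ltr1n.
rewrite /dstep (@near_eq_derive _ _ _ _ (cst (1 : R))) ?derive_cst//.
by near=> y; rewrite step_ge_half// ltW//; near: y; exact: lt_nbhsr.
Unshelve. all: by end_near. Qed.

(** The derivative is continuous and vanishes outside [0, 1]. *)
Lemma dstep_bounded : exists2 K, 0 <= K & forall z, `|dstep z| <= K.
Proof.
have [|c c01 cmax] := @EVT_max R (fun z => `|dstep z|) 0 1 ler01.
  apply: continuous_subspaceT => z.
  apply: (@continuous_comp _ _ _ dstep (fun y : R => `|y|)).
    exact: continuous_dstep.
  exact: norm_continuous.
exists `|dstep c| => [|z]; first exact: normr_ge0.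
have [/dstep_le0 ->|z0] := leP z 0; first by rewrite normr0.
have [/dstep_ge1 ->|z1] := leP 1 z; first by rewrite normr0.
by apply: cmax; rewrite in_itv/= (ltW z0) (ltW z1).
Qed.

End step.

(** * Smooth functions of several variables *)

Section smooth_rV.
Context (R : realType) (d : nat).
Implicit Types f g : 'rV[R]_d -> R.

Inductive smooth_rV : ('rV[R]_d -> R) -> Prop :=
| smooth_rV_coord i : smooth_rV (fun x => x 0 i)
| smooth_rV_add f g : smooth_rV f -> smooth_rV g -> smooth_rV (fun x => f x + g x)
| smooth_rV_mul f g : smooth_rV f -> smooth_rV g -> smooth_rV (fun x => f x * g x)
| smooth_rV_cst c : smooth_rV (fun=> c)
| smooth_rV_comp h f : smooth1 h -> smooth_rV f -> smooth_rV (fun x => h (f x)).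

Lemma is_derive_lineP f (x v : 'rV[R]_d) l :
  is_derive x v f l <-> is_derive (0 : R) 1 (fun t => f (t *: v + x)) l.
Proof.
have E : (fun h => h^-1 *: (((fun t : R => f (t *: v + x)) \o shift (0:R)) (h *: 1)
    - f (0 *: v + x))) = (fun h => h^-1 *: ((f \o shift x) (h *: v) - f x)).
  apply/funext => h /=; rewrite scale0r add0r addr0; congr (_ *: (f _ - _)).
  by rewrite [_ *: 1]mulr1.
split=> -[H1 H2]; split.
- by rewrite /derivable E.
- by rewrite /derive E.
- by rewrite /derivable -E.
- by rewrite /derive -E.
Qed.

(** The chain rule along a line: f is only known to be derivable in the direction
    v, so the rule is applied to the restriction of f to that line. *)
Lemma is_derive_comp_rV (h : R -> R) f (x v : 'rV[R]_d) l m :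
  is_derive (f x) 1 h l -> is_derive x v f m ->
  is_derive x v (fun x => h (f x)) (l * m).
Proof.
move=> dh /is_derive_lineP df; apply/is_derive_lineP.
apply: (@is_derive1_comp _ h (fun t => f (t *: v + x)) 0 l m) => //.
by rewrite scale0r add0r.
Qed.

Lemma is_derive_coord_rV (x : 'rV[R]_d) i j :
  is_derive x (delta_mx 0 i) (fun y : 'rV[R]_d => y 0 j) (i == j)%:R.
Proof.
apply/is_derive_lineP.
have -> : (fun t : R => (t *: delta_mx 0 i + x) 0 j) =
    ((i == j)%:R \*: id) + cst (x 0 j).
  by apply/funext => t; rewrite !mxE /= [j == i]eq_sym mulrC.
by apply: is_derive_eq; rewrite addr0 [LHS]mulr1.
Qed.

Lemma smooth_rV_sum (I : Type) (s : seq I) (F : I -> 'rV[R]_d -> R) :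
  (forall i, smooth_rV (F i)) -> smooth_rV (fun x => \sum_(i <- s) F i x).
Proof.
move=> sF; elim: s => [|i s IH].
  rewrite (_ : (fun x => _) = fun=> 0); first exact: smooth_rV_cst.
  by apply/funext => x; rewrite big_nil.
rewrite (_ : (fun x => _) = fun x => F i x + \sum_(j <- s) F j x).
  exact: smooth_rV_add.
by apply/funext => x; rewrite big_cons.
Qed.

Lemma smooth_rV_partial f i : smooth_rV f ->
  exists2 f', smooth_rV f' & forall x, is_derive x (delta_mx 0 i) f (f' x).
Proof.
elim=> {f} [j|f g sf [f' sf' df] sg [g' sg' dg]|f g sf [f' sf' df] sg [g' sg' dg]
  |c|h f sh sf [f' sf' df]].
- exists (fun=> (i == j)%:R); first exact: smooth_rV_cst.
  by move=> x; exact: is_derive_coord_rV.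
- exists (fun z => f' z + g' z); first exact: smooth_rV_add.
  by move=> z; exact: is_deriveD.
- exists (fun z => f z * g' z + g z * f' z).
    by apply: smooth_rV_add; apply: smooth_rV_mul.
  by move=> z; exact: is_deriveM.
- by exists (fun=> 0); [exact: smooth_rV_cst|move=> z; exact: is_derive_cst].
- have [h' sh' dh] := smooth1_derive sh.
  exists (fun z => h' (f z) * f' z).
    by apply: smooth_rV_mul => //; apply: smooth_rV_comp.
  by move=> z; exact: is_derive_comp_rV.
Qed.

Lemma smooth_rV_continuous f : smooth_rV f -> continuous f.
Proof.
elim=> {f} [j|f g sf cf sg cg|f g sf cf sg cg|c|h f sh sf cf] x.
- exact: coord_continuous.
- have c1 : f z @[z --> x] --> f x by exact: cf.
  have c2 : g z @[z --> x] --> g x by exact: cg.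
  exact: (cvgD c1 c2).
- have c1 : f z @[z --> x] --> f x by exact: cf.
  have c2 : g z @[z --> x] --> g x by exact: cg.
  exact: (cvgM c1 c2).
- exact: cst_continuous.
- apply: (@continuous_comp _ _ _ f h); first exact: cf.
  exact: smooth1_continuous.
Qed.

(** The class is closed under partial derivatives, and its members are
    continuous. *)
Lemma smooth_rV_smooth f : smooth_rV f -> smooth f.
Proof.
move=> sf s.
have {sf} : smooth_rV (foldr (@partial R d) f s).
  elim: s => [|i s IH]//=.
  have [f' sf' df] := smooth_rV_partial i IH.
  have -> // : partial i (foldr (@partial R d) f s) = f'.
  by apply/funext => x; rewrite /partial; have [_ ->] := df x.
move=> sg; split; first exact: smooth_rV_continuous.
by move=> i x; have [f' _ df] := smooth_rV_partial i sg; have [] := df x.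
Qed.

End smooth_rV.

(** * The dilation-invariant measure of dyadic shells *)

Section shells.
Context (R : realType) (d : nat).
Hypothesis d1 : (1 <= d)%N.

Definition shell (s t : R) : set (borel_rV R d) :=
  Omega R d `&` [set x | s <= enorm (x : 'rV[R]_d) < t].

Definition shell_density (s t : R) (x : borel_rV R d) : R :=
  \1_(shell s t) x * enorm (x : 'rV[R]_d) `^ (- d%:R).

Definition shell_mass (s t : R) : \bar R :=
  (\int[lebesgue_rV R d]_x (shell_density s t x)%:E)%E.

Lemma measurable_enorm : measurable_fun setT (fun x : borel_rV R d => enorm (x : 'rV[R]_d)).
Proof. by apply: continuous_measurable_rV; exact: continuous_enorm. Qed.

Lemma measurable_shell s t : measurable (shell s t).
Proof.
apply: measurableI; first exact: measurable_Omega.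
rewrite -[X in measurable X]setTI.
have -> : [set x : borel_rV R d | s <= enorm (x : 'rV[R]_d) < t] =
    (fun x : borel_rV R d => enorm (x : 'rV[R]_d)) @^-1` `[s, t[.
  by apply/seteqP; split=> x /=; rewrite in_itv.
by apply: measurable_enorm => //; exact: measurable_itv.
Qed.

Lemma shell_density_ge0 s t x : 0 <= shell_density s t x.
Proof. by rewrite mulr_ge0 ?powR_ge0. Qed.

Lemma measurable_shell_density s t : measurable_fun setT (shell_density s t).
Proof.
apply: measurable_funM; first by apply: measurable_indic; exact: measurable_shell.
exact: (measurableT_comp (measurable_powR _) measurable_enorm).
Qed.

Lemma OmegaZ (t : R) (x : 'rV[R]_d) : 0 < t -> Omega R d (t *: x) <-> Omega R d x.
Proof.
move=> t0; rewrite /Omega; case: ifP => // _; split=> /= H i; have := H i.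
  by rewrite mxE pmulr_rgt0.
by rewrite mxE pmulr_rgt0.
Qed.

(** The density |x|^(-d) gains r^d under the dilation by r, which compensates the
    scaling of the Lebesgue measure. *)
Lemma shell_massZ (r s t : R) : 0 < r -> shell_mass (r * s) (r * t) = shell_mass s t.
Proof.
move=> r0; have r'0 : 0 < r^-1 by rewrite invr_gt0.
have E x : shell_density s t (r^-1 *: (x : 'rV[R]_d)) =
    r ^+ d * shell_density (r * s) (r * t) x.
  rewrite /shell_density enormZ gtr0_norm// powRM ?enorm_ge0 ?(ltW r'0)//.
  rewrite powRN (powR_mulrn _ (ltW r'0)) exprVn invrK.
  rewrite mulrCA; congr (_ * (_ * _)); rewrite !indicE; congr ((nat_of_bool _)%:R).
  have nE : enorm (r^-1 *: (x : 'rV[R]_d)) = r^-1 * enorm (x : 'rV[R]_d).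
    by rewrite enormZ gtr0_norm.
  have iE : (s <= r^-1 * enorm (x : 'rV[R]_d) < t) = (r * s <= enorm (x : 'rV[R]_d) < r * t).
    by rewrite ler_pdivlMl// ltr_pdivrMl.
  apply/idP/idP; rewrite !inE /shell => -[xO xst]; split.
  - exact: (OmegaZ x r'0).1.
  - by move: xst; rewrite /= nE iE.
  - exact: (OmegaZ x r'0).2.
  - by move: xst; rewrite /= nE iE.
have ms := @measurable_shell_density s t.
have ms' := @measurable_shell_density (r * s) (r * t).
have mse : measurable_fun setT (EFin \o shell_density s t) by exact/measurable_EFinP.
have H := ge0_integralZ_lebesgue_rV r'0 mse.
have {}H := H (fun x => _ : (0 <= (EFin \o shell_density s t) x)%E).
have rd0 : 0 <= r ^+ d by rewrite exprn_ge0// ltW.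
have : (\int[lebesgue_rV R d]_x (r ^+ d * shell_density (r * s) (r * t) x)%:E =
    (r ^+ d)%:E * shell_mass s t)%E.
  rewrite [in X in (X * _)%E](_ : r ^+ d = r^-1 ^- d); last by rewrite exprVn invrK.
  rewrite -H; last by move=> x; rewrite lee_fin shell_density_ge0.
  by apply: eq_integral => x _; rewrite /= E.
rewrite (ge0_integralZ_EFin _ rd0 ms' (shell_density_ge0 _ _)).
move=> /(congr1 (mule (r ^- d)%:E)); rewrite !muleA -!EFinM mulVf ?mul1e//.
by rewrite expf_neq0// gt_eqF.
Qed.

Lemma shell_mass_split s r t : s <= r -> r <= t ->
  shell_mass s t = (shell_mass s r + shell_mass r t)%E.
Proof.
move=> sr rt.
have E x : shell_density s t x = 1 * shell_density s r x + 1 * shell_density r t x.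
  rewrite !mul1r -mulrDl; congr (_ * _); rewrite !indicE.
  have [xO|xO] := pselect (Omega R d x); last first.
    by rewrite !memNset ?addr0// => -[].
  have mE a b : (x \in shell a b) = (a <= enorm (x : 'rV[R]_d) < b).
    by apply/idP/idP => [/set_mem[]//|h]; apply/mem_set; split.
  rewrite !mE; case: (ltP (enorm (x : 'rV[R]_d)) r) => xr.
    by rewrite (lt_le_trans xr rt) addr0.
  by rewrite andbF (le_trans sr xr)/= add0r.
rewrite /shell_mass; under eq_integral do rewrite E.
rewrite (ge0_integral_lincomb _ ler01 ler01 (@measurable_shell_density _ _)
  (@measurable_shell_density _ _) (shell_density_ge0 _ _) (shell_density_ge0 _ _)).
by rewrite !mul1e.
Qed.

Lemma shell_mass_lty s t : 0 < s -> (shell_mass s t < +oo)%E.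
Proof.
move=> s0; have [t0|t0] := leP t 0.
  rewrite /shell_mass integral0_eq ?ltry// => x _; rewrite /shell_density indicE.
  rewrite memNset ?mul0r// => -[_ /= /andP[_ xt]].
  by move: (le_lt_trans (enorm_ge0 _) (lt_le_trans xt t0)); rewrite ltxx.
pose B := s `^ (- d%:R).
have mB := @measurable_box_rV R d (- t) t.
apply: (@le_lt_trans _ _ (\int[lebesgue_rV R d]_(x in @box_rV R d (- t) t) B%:E)%E).
  rewrite [leRHS]integral_mkcond; apply: ge0_le_integral => //.
  - by move=> x _; rewrite lee_fin shell_density_ge0.
  - by apply/measurable_EFinP; exact: measurable_shell_density.
  - by apply/(measurable_restrictT _ mB); exact: measurable_cst.
  - move=> x _; rewrite /shell_density indicE patchE.
    have [xS|xS] := boolP (x \in shell s t); last first.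
      by rewrite mul0r; case: ifP => _; rewrite lee_fin// powR_ge0.
    have [xO /= /andP[sx xt]] := set_mem xS.
    rewrite ifT; last first.
      rewrite inE => i; rewrite in_itv/= -ler_norml.
      exact: (le_trans (ler_coord_enorm _ _) (ltW xt)).
    rewrite mul1r lee_fin /B !powRN lef_pV2 ?posrE ?powR_gt0 ?(lt_le_trans s0)//.
    by rewrite ge0_ler_powR ?nnegrE ?ler0n ?enorm_ge0 ?(ltW s0).
rewrite integral_cst//=.
have -> : lebesgue_rV R d (box_rV (- t) t) = ((t - - t) ^+ d)%:E.
  by rewrite lebesgue_rV_box//; lra.
by rewrite -EFinM ltry.
Qed.

(** By invariance the shell may be replaced by the one that starts at sqrt d; it
    contains the cube [1, 3/2]^d, which lies in Omega in every dimension. *)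
Lemma shell_mass_gt0 : (0 < shell_mass 1 2)%E.
Proof.
have d0 : 0 < d%:R :> R by rewrite ltr0n.
pose s : R := Num.sqrt d%:R.
have s0 : 0 < s by rewrite sqrtr_gt0.
rewrite -(shell_massZ 1 2 s0) mulr1.
pose b : R := 3 / 2.
have mB := @measurable_box_rV R d 1 b.
pose B := (s * 2) `^ (- d%:R).
have B0 : 0 < B by rewrite powR_gt0// mulr_gt0.
apply: (@lt_le_trans _ _ (\int[lebesgue_rV R d]_(x in @box_rV R d 1 b) B%:E)%E).
  rewrite integral_cst//=.
  have -> : lebesgue_rV R d (box_rV 1 b) = ((b - 1) ^+ d)%:E.
    by rewrite lebesgue_rV_box// /b; lra.
  by rewrite -EFinM lte_fin mulr_gt0// exprn_gt0// /b; lra.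
rewrite [leLHS]integral_mkcond; apply: ge0_le_integral => //.
- by move=> x _; rewrite patchE; case: ifP => _; rewrite lee_fin// ltW.
- by apply/(measurable_restrictT _ mB); exact: measurable_cst.
- by apply/measurable_EFinP; exact: measurable_shell_density.
- move=> x _; rewrite patchE; case: ifPn => [xB|_]; last first.
    by rewrite lee_fin shell_density_ge0.
  have {xB}xB i : 1 <= (x : 'rV[R]_d) 0 i <= b.
    by have := set_mem xB; move=> /(_ i); rewrite in_itv.
  have xO : Omega R d x.
    rewrite /Omega; case: ifP => // _ i.
    by have /andP[x1 _] := xB i; exact: lt_le_trans x1.
  have sx : s <= enorm (x : 'rV[R]_d).
    rewrite /s /enorm ler_wsqrtr//.
    have -> : d%:R = \sum_(i < d) 1 :> R by rewrite sumr_const card_ord.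
    rewrite ler_sum// => i _.
    have /andP[x1 _] := xB i.
    by rewrite -[leLHS](expr1n _ 2) lerXn2r ?nnegrE// (le_trans _ x1).
  have xs : enorm (x : 'rV[R]_d) <= s * b.
    have b0 : 0 <= b by rewrite /b; lra.
    rewrite -(ger0_norm b0) -sqrtr_sqr /s -sqrtrM ?(ltW d0)// /enorm ler_wsqrtr//.
    have -> : d%:R = \sum_(i < d) 1 :> R by rewrite sumr_const card_ord.
    rewrite mulr_suml ler_sum// => i _.
    have /andP[x1 x2] := xB i.
    by rewrite mul1r lerXn2r ?nnegrE// (le_trans _ x1).
  have xs2 : enorm (x : 'rV[R]_d) < s * 2.
    by apply: (le_lt_trans xs); rewrite ltr_pM2l// /b; lra.
  rewrite /shell_density indicE mem_set ?mul1r; last by split => //=; rewrite sx xs2.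
  have x0 : 0 < enorm (x : 'rV[R]_d) by exact: lt_le_trans sx.
  rewrite lee_fin /B !powRN lef_pV2 ?posrE ?powR_gt0 ?mulr_gt0//.
  by rewrite ge0_ler_powR ?nnegrE ?ler0n ?(ltW x0)// ltW// mulr_gt0.
Qed.

Lemma shell_mass_dyadic (r : R) n : 0 < r ->
  shell_mass (r / 2 ^+ n) r = (n%:R%:E * shell_mass 1 2)%E.
Proof.
move=> r0; elim: n => [|n IH].
  rewrite expr0 divr1 mul0e /shell_mass integral0_eq// => x _.
  rewrite /shell_density indicE memNset ?mul0r// => -[_ /= /andP[h1 h2]].
  by move: (le_lt_trans h1 h2); rewrite ltxx.
have p2 : 0 < (2:R) ^+ n.+1 by rewrite exprn_gt0.
have e1 : r / 2 ^+ n = r / 2 ^+ n.+1 * 2.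
  by rewrite exprS; field; rewrite expf_neq0.
rewrite (@shell_mass_split _ (r / 2 ^+ n)); last 2 first.
- by rewrite e1 ler_peMr ?ler1n// ltW// divr_gt0.
- by rewrite ler_pdivrMr ?exprn_gt0// ler_peMr ?exprn_ege1 ?ler1n// ltW.
rewrite IH e1 -[X in shell_mass X _]mulr1 shell_massZ ?divr_gt0//.
move: (shell_mass 1 2) => J.
have -> : n.+1%:R = n%:R + 1 :> R by rewrite -natr1.
by rewrite EFinD ge0_muleDl ?lee_fin ?ler0n// mul1e addeC.
Qed.

End shells.

(** * The radial profile *)

Section profile.
Context (R : realType).
Variables (al be b : R).
Hypotheses (al0 : 0 < al) (albe : 4 * al <= be).

Let be0 : 0 < be. Proof. by apply: lt_le_trans albe; rewrite mulr_gt0. Qed.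

Let low_arg (z : R) := (z / al - 1) / 3.
Let high_arg (z : R) := (4 - z / be) / 3.

(** In the variable z = |x|^2, a dyadic shell is a ratio 4: the cutoff rises on
    [al, 4 al] and falls on [be, 4 be]. *)
Definition cutoff z := step (low_arg z) * step (high_arg z).
Definition cutoff' z :=
  step (low_arg z) * (dstep (high_arg z) * (- (3 * be)^-1)) + step (high_arg z) * (dstep (low_arg z) * (3 * al)^-1).
Definition profile z := z `^ b * cutoff z.

Let affine (m q : R) : smooth1 (fun z => m * z + q).
Proof.
apply: smooth1_add; last exact: smooth1_cst.
by apply: smooth1_mul; [exact: smooth1_cst|exact: smooth1_id].
Qed.

Let low_argE : low_arg = fun z => (3 * al)^-1 * z + - 3^-1.
Proof. by apply/funext => z; rewrite /low_arg; field; rewrite gt_eqF. Qed.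
Let high_argE : high_arg = fun z => - (3 * be)^-1 * z + 4 / 3.
Proof. by apply/funext => z; rewrite /high_arg; field; rewrite gt_eqF. Qed.

Lemma smooth1_cutoff : smooth1 cutoff.
Proof.
apply: smooth1_mul; apply: smooth1_comp; try exact: smooth1_step.
  by rewrite low_argE; exact: affine.
by rewrite high_argE; exact: affine.
Qed.

Let daffine (m q z : R) : is_derive z 1 (fun z => m * z + q) m.
Proof.
have -> : (fun z => m * z + q) = (m \*: id) + cst q by [].
by apply: is_derive_eq; rewrite addr0 [LHS]mulr1.
Qed.

Lemma is_derive_cutoff (z : R) : is_derive z 1 cutoff (cutoff' z).
Proof.
have d1 : is_derive z 1 low_arg ((3 * al)^-1) by rewrite low_argE.
have d2 : is_derive z 1 high_arg (- (3 * be)^-1) by rewrite high_argE.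
have D1 := @is_derive1_comp _ (@step R) low_arg _ _ _ (is_derive_step (low_arg z)) d1.
have D2 := @is_derive1_comp _ (@step R) high_arg _ _ _ (is_derive_step (high_arg z)) d2.
exact: (is_deriveM D1 D2).
Qed.

Lemma cutoff_itv z : 0 <= cutoff z <= 1.
Proof.
have /andP[a0 a1] := step_itv (low_arg z); have /andP[b0 b1] := step_itv (high_arg z).
by apply/andP; split; [exact: (mulr_ge0 a0 b0)|exact: (mulr_ile1 a0 b0 a1 b1)].
Qed.

Lemma cutoff_low z : z <= al -> cutoff z = 0.
Proof.
move=> za; rewrite /cutoff step_le0 ?mul0r// /low_arg.
have : z / al <= 1 by rewrite ler_pdivrMr// mul1r.
lra.
Qed.

Lemma cutoff_high z : 4 * be <= z -> cutoff z = 0.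
Proof.
move=> zb; rewrite /cutoff [step (high_arg z)]step_le0 ?mulr0// /high_arg.
have : 4 <= z / be by rewrite ler_pdivlMr.
lra.
Qed.

Lemma cutoff'_high z : 4 * be <= z -> cutoff' z = 0.
Proof.
move=> zb; have h : high_arg z <= 0.
  rewrite /high_arg; have : 4 <= z / be by rewrite ler_pdivlMr.
  lra.
by rewrite /cutoff' (dstep_le0 h) (step_le0 h) !(mul0r, mulr0) addr0.
Qed.

Lemma cutoff_plateau z : 4 * al <= z <= be -> cutoff z = 1 /\ cutoff' z = 0.
Proof.
move=> /andP[za zb].
have h1 : 1 <= low_arg z.
  have : 4 <= z / al by rewrite ler_pdivlMr.
  rewrite /low_arg; lra.
have h2 : 1 <= high_arg z.
  have : z / be <= 1 by rewrite ler_pdivrMr// mul1r.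
  rewrite /high_arg; lra.
have h w : 1 <= w -> step w = 1 :> R.
  move=> w1'; apply: step_ge_half; apply: le_trans w1'.
  by rewrite invf_le1// ler1n.
by rewrite /cutoff /cutoff' !h// !dstep_ge1// !mul0r !mulr0 addr0 mulr1.
Qed.

(** Where the first factor of the cutoff varies, z / al lies in [1, 4], and where
    the second one varies, z / be does: this bounds z times the derivative
    independently of al and be. *)
Lemma cutoff'_le K z : 0 <= K -> (forall y, `|dstep y| <= K) -> 0 <= z -> `|z * cutoff' z| <= 4 * K.
Proof.
move=> K0 dstep_le z0.
have bnd w q : (0 < w < 1 -> 0 <= q <= 2) -> `|q * dstep w| <= 2 * K.
  move=> wq; have [w0|w0] := leP w 0.
    by rewrite dstep_le0// mulr0 normr0 mulr_ge0.
  have [w1'|w1'] := leP 1 w; first by rewrite dstep_ge1// mulr0 normr0 mulr_ge0.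
  have /andP[q0 q2] := wq (introT andP (conj w0 w1')).
  by rewrite normrM ler_pM// ger0_norm.
have B1 : `|(z / (3 * al)) * dstep (low_arg z)| <= 2 * K.
  apply: bnd; have -> : z / (3 * al) = low_arg z + 3^-1.
    by rewrite /low_arg; field; rewrite gt_eqF.
  move=> /andP[]; lra.
have B2 : `|(z / (3 * be)) * dstep (high_arg z)| <= 2 * K.
  apply: bnd; have -> : z / (3 * be) = 4 / 3 - high_arg z.
    by rewrite /high_arg; field; rewrite gt_eqF.
  move=> /andP[]; lra.
have -> : z * cutoff' z = step (high_arg z) * ((z / (3 * al)) * dstep (low_arg z)) -
    step (low_arg z) * ((z / (3 * be)) * dstep (high_arg z)).
  have aux (s1 s2 t1 t2 x y : R) : z * (s1 * (t2 * - x) + s2 * (t1 * y)) =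
      s2 * ((z * y) * t1) - s1 * ((z * x) * t2) by ring.
  exact: aux.
rewrite (le_trans (ler_normB _ _))// [4 * K](_ : _ = 2 * K + 2 * K); last by ring.
have sn w : `|step w| <= 1 :> R.
  by have /andP[s0 s1] := @step_itv R w; rewrite ger0_norm.
apply: lerD; rewrite normrM -[leRHS]mul1r.
  exact: (ler_pM (normr_ge0 _) (normr_ge0 _) (sn _) B1).
exact: (ler_pM (normr_ge0 _) (normr_ge0 _) (sn _) B2).
Qed.

Lemma smooth1_profile : smooth1 profile.
Proof.
apply: (@smooth1_powR _ _ al) => //; last exact: smooth1_cutoff.
by move=> z za; rewrite cutoff_low// ltW.
Qed.

Lemma is_derive_profile (z : R) : 0 < z ->
  is_derive z 1 profile (z `^ b / z * (b * cutoff z + z * cutoff' z)).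
Proof.
move=> z0; have := is_deriveM (is_derive1_powR b z0) (is_derive_cutoff z).
rewrite /GRing.scale/=.
have -> : z `^ b * cutoff' z + cutoff z * (b * z `^ (b - 1)) =
    z `^ b / z * (b * cutoff z + z * cutoff' z).
  rewrite powRB ?powRr1 ?ltW//; last by apply/implyP => _; rewrite gt_eqF.
  by field; rewrite gt_eqF.
exact.
Qed.

End profile.

(** * The test functions *)

Section testfun.
Context (R : realType) (d : nat) (p a : R).
Hypotheses (d1 : (1 <= d)%N) (p1 : 1 < p).
Variables (t r : R).
Hypotheses (t0 : 0 < t) (tr : 2 * t <= r).

Let s := p * (a + 1).
Let k := d%:R - s.
Let kap := `|k| / p.
(* So that (|x|^2)^b = |x|^(- k / p). *)
Let b := - (k / p) / 2.
Let al := t ^+ 2.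
Let be := r ^+ 2.
Let p0 : 0 < p. Proof. exact: lt_trans p1. Qed.
Let r0 : 0 < r. Proof. by apply: lt_le_trans tr; rewrite mulr_gt0. Qed.
Let al0 : 0 < al. Proof. exact: exprn_gt0. Qed.
Let albe : 4 * al <= be.
Proof.
have -> : 4 * al = (2 * t) ^+ 2 by rewrite /al; ring.
by rewrite /be lerXn2r ?nnegrE ?mulr_ge0// ltW.
Qed.

Let chi := cutoff al be.
Let chi' := cutoff' al be.
Let prof := profile al be b.

Definition sqnorm (x : 'rV[R]_d) := \sum_i x 0 i ^+ 2.

(** In dimension one the factor step (x / t) kills the negative half-line; it is 1
    wherever the profile is nonzero on the positive one. *)
Definition radial_test (x : 'rV[R]_d) : R :=
  prof (sqnorm x) * (if d == 1%N then step (x 0 (Ordinal d1) / t) else 1).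

Lemma smooth_rV_sqnorm : smooth_rV sqnorm.
Proof.
apply: (@smooth_rV_sum _ _ _ _ (fun i (x : 'rV[R]_d) => x 0 i ^+ 2)) => i.
rewrite (_ : (fun x => _) = fun x : 'rV[R]_d => x 0 i * x 0 i).
  by apply: smooth_rV_mul; exact: smooth_rV_coord.
by apply/funext => x; rewrite expr2.
Qed.

Lemma smooth_radial_test : smooth radial_test.
Proof.
apply: smooth_rV_smooth; apply: smooth_rV_mul.
  apply: smooth_rV_comp; last exact: smooth_rV_sqnorm.
  exact: smooth1_profile.
case: (d == 1%N); last exact: smooth_rV_cst.
apply: (@smooth_rV_comp _ _ (@step R)); first exact: smooth1_step.
apply: smooth_rV_mul; last exact: smooth_rV_cst.
exact: smooth_rV_coord.
Qed.

Lemma radial_testE (x : 'rV[R]_d) : Omega R d x -> radial_test x = prof (sqnorm x).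
Proof.
rewrite /Omega /radial_test; case: ifP => [d1E|_ _]; last by rewrite mulr1.
move=> /= xp; set x0 := x 0 _.
have x0p : 0 < x0 by exact: xp.
have sE : sqnorm x = x0 ^+ 2.
  rewrite /sqnorm (bigD1 (Ordinal d1))//= big1 ?addr0// => i /negP[].
  by apply/eqP/val_inj => /=; have := ltn_ord i; move/eqP: d1E; lia.
have [h|h] := leP (2^-1) (x0 / t); first by rewrite step_ge_half ?mulr1.
have xt : sqnorm x <= al.
  rewrite sE /al lerXn2r ?nnegrE ?(ltW x0p) ?(ltW t0)//.
  move: h; rewrite ltr_pdivrMr// => h; rewrite (le_trans (ltW h))//.
  by rewrite ler_piMl ?(ltW t0)// invf_le1// ler1n.
by rewrite /prof /profile (cutoff_low be al0 xt) mulr0 mul0r.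
Qed.

Lemma sqnormE (x : 'rV[R]_d) : sqnorm x = enorm x ^+ 2.
Proof. by rewrite sqr_enorm. Qed.

Lemma radial_test_neq0 x : radial_test x != 0 ->
  t <= enorm x <= 2 * r /\ (if d == 1%N then 0 <= x 0 (Ordinal d1) else true).
Proof.
rewrite /radial_test mulf_eq0 negb_or => /andP[pr0 st0]; split; last first.
  move: st0; case: ifP => // _; apply: contraR; rewrite -ltNge => x0.
  by rewrite step_le0// ler_pdivrMr// mul0r ltW.
rewrite -(ler_pXn2r (_ : (0 < 2)%N)) ?nnegrE ?enorm_ge0 ?(ltW t0)//.
rewrite -[X in _ && X](ler_pXn2r (_ : (0 < 2)%N)) ?nnegrE ?enorm_ge0 ?mulr_ge0 ?(ltW r0)//.
rewrite -sqnormE.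
have -> : (2 * r) ^+ 2 = 4 * be by rewrite /be; ring.
apply/andP; split; rewrite leNgt; apply: contra pr0 => h; rewrite /prof /profile.
  by rewrite (cutoff_low be al0 (ltW h)) mulr0.
by rewrite (cutoff_high al0 albe (ltW h)) mulr0.
Qed.

(** The sign condition for d = 1, together with the lower bound on |x|, keeps the
    support away from 0 and inside the open half-line. *)
Lemma support_radial_test : Defs.support radial_test `<=`
  [set x : 'rV[R]_d | t <= enorm x] `&` [set x : 'rV[R]_d | enorm x <= 2 * r] `&`
  [set x : 'rV[R]_d | if d == 1%N then 0 <= x 0 (Ordinal d1) else true].
Proof.
set C := (X in _ `<=` X).
have cC : closed C.
  have ce := @continuous_enorm R d.
  apply: closedI; first apply: closedI.
  - by apply: (@closed_comp _ _ (@enorm R d) [set y | t <= y]) => //; exact: closed_ge.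
  - by apply: (@closed_comp _ _ (@enorm R d) [set y | y <= 2 * r]) => //; exact: closed_le.
  - case: (d == 1%N); last first.
      by rewrite (_ : [set _ | _] = setT)//; apply/seteqP; split.
    apply: (@closed_comp _ _ (fun x : 'rV[R]_d => x 0 (Ordinal d1)) [set y | 0 <= y]).
      by move=> x _; exact: coord_continuous.
    exact: closed_ge.
rewrite [X in _ `<=` X]((closure_id C).1 cC); apply: closureS => x.
by move=> /radial_test_neq0 [/andP[h1 h2] h3].
Qed.

Lemma Cc_radial_test : Cc_infty0 radial_test.
Proof.
have sC := support_radial_test.
split; first exact: smooth_radial_test.
- apply: bounded_closed_compact; last exact: closed_closure.
  exists (2 * r); split; first exact: num_real.
  move=> M rM x /sC [[_ /= xr] _].
  rewrite [leLHS]/Num.Def.normr/= mx_normrE; apply/bigmax_leP; split=> [|[i j] _].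
    by rewrite (le_trans _ (ltW rM))// mulr_ge0// ltW.
  by rewrite ord1 (le_trans (ler_coord_enorm _ _))// (le_trans xr)// ltW.
- move=> x /sC [[/= xt _]].
  have x0 : x != 0.
    by apply: contraTneq xt => ->; rewrite enorm0 -ltNge.
  have [d1E|d1E] := eqVneq d 1%N; last by move=> _; exact/Omega0P.
  have dT : (d == 1%N) = true by rewrite d1E eqxx.
  move=> /= xp; rewrite /Omega0 ifT//= => i.
  have iE j : j = Ordinal d1 by apply/val_inj => /=; have := ltn_ord j; lia.
  rewrite (iE i) lt_neqAle xp andbT eq_sym; apply: contra x0 => /eqP xi.
  by apply/eqP/rowP => j; rewrite mxE (iE j).
Qed.

Lemma is_derive_sqnorm (x : 'rV[R]_d) i :
  is_derive x (delta_mx 0 i) sqnorm (2 * x 0 i).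
Proof.
have -> : sqnorm = \sum_(j < d) (fun y : 'rV[R]_d => y 0 j * y 0 j).
  apply/funext => y; rewrite /sqnorm fct_sumE.
  by apply: eq_bigr => j _; rewrite expr2.
have -> : 2 * x 0 i = \sum_(j < d) (x 0 j * (i == j)%:R + x 0 j * (i == j)%:R).
  rewrite (bigD1 i)//= eqxx mulr1 big1 ?addr0; first by ring.
  by move=> j ji; rewrite eq_sym (negbTE ji) !mulr0 addr0.
apply: is_derive_sum => j.
exact: (is_deriveM (is_derive_coord_rV x i j) (is_derive_coord_rV x i j)).
Qed.

Lemma open_Omega : open (Omega R d : set 'rV[R]_d).
Proof.
have [dE|dE] := boolP (d == 1%N); last by rewrite /Omega ifN//; exact: openT.
have -> : Omega R d = (fun x : 'rV[R]_d => x 0 (Ordinal d1)) @^-1` [set y | 0 < y].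
  have iE j : j = Ordinal d1.
    by apply/val_inj => /=; have := ltn_ord j; move/eqP: dE; lia.
  apply/seteqP; split=> x; rewrite /Omega ifT//=.
  by move=> xp i; rewrite (iE i).
apply: open_comp; last exact: open_gt.
by move=> x _; exact: coord_continuous.
Qed.

Lemma enorm_gradient_radial (x : 'rV[R]_d) : Omega R d x -> 0 < sqnorm x ->
  enorm (gradient radial_test x) =
  `|2 * (sqnorm x `^ b / sqnorm x * (b * chi (sqnorm x) + sqnorm x * chi' (sqnorm x)))|
  * enorm x.
Proof.
move=> xO x0; rewrite -enormZ; congr enorm; apply/rowP => i.
rewrite /gradient !mxE /partial.
have nu : \near x, radial_test x = prof (sqnorm x).
  have : nbhs x (Omega R d) by apply: open_nbhs_nbhs; split => //; exact: open_Omega.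
  by apply: filterS => y; exact: radial_testE.
rewrite (near_eq_derive _ nu).
have D := is_derive_comp_rV (is_derive_profile b al0 albe x0) (is_derive_sqnorm x i).
by have [_ ->] := D; rewrite -/chi -/chi'; ring.
Qed.

Lemma radial_test_off_shell (x : 'rV[R]_d) : ~~ (t <= enorm x <= 2 * r) ->
  radial_test x = 0 /\ gradient radial_test x = 0.
Proof.
move=> xtr; apply: gradient_off_support => /support_radial_test[[/= xt xr] _].
by move: xtr; rewrite xt xr.
Qed.

Let sqnorm_powR (x : 'rV[R]_d) (e : R) : sqnorm x `^ e = enorm x `^ (2 * e).
Proof. by rewrite sqnormE powRrM powR_mulrn ?enorm_ge0. Qed.

Let b2 : 2 * b = - (k / p).
Proof. by rewrite /b; field; rewrite gt_eqF. Qed.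

Lemma lhs_radial (x : 'rV[R]_d) : Omega R d x -> 0 < enorm x ->
  `|radial_test x| `^ p / enorm x `^ s = chi (sqnorm x) `^ p * enorm x `^ (- d%:R).
Proof.
move=> xO X0; rewrite radial_testE// /prof /profile -/chi.
have /andP[c0 c1] := cutoff_itv al be (sqnorm x).
rewrite normrM (ger0_norm (powR_ge0 _ _)) (ger0_norm c0) powRM ?powR_ge0//.
rewrite sqnorm_powR -powRrM -powRN mulrAC [LHS]mulrC; congr (_ * _).
rewrite -powRD; last by apply/implyP => _; rewrite gt_eqF.
by congr (_ `^ _); rewrite b2 /k; field; rewrite gt_eqF.
Qed.

Lemma grad_radial (x : 'rV[R]_d) : Omega R d x -> 0 < enorm x ->
  enorm (gradient radial_test x) `^ p / enorm x `^ (p * a) =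
  `|2 * b * chi (sqnorm x) + 2 * (sqnorm x * chi' (sqnorm x))| `^ p
   * enorm x `^ (- d%:R).
Proof.
move=> xO X0; have Xn0 : enorm x != 0 by rewrite gt_eqF.
have z0 : 0 < sqnorm x by rewrite sqnormE exprn_gt0.
rewrite enorm_gradient_radial//.
set w := b * _ + _.
have -> : 2 * b * chi (sqnorm x) + 2 * (sqnorm x * chi' (sqnorm x)) = 2 * w.
  by rewrite /w; ring.
have -> : 2 * (sqnorm x `^ b / sqnorm x * w) = (2 * w) * (enorm x `^ (2 * b - 2)).
  rewrite powRB ?Xn0 ?implybT//.
  by rewrite sqnorm_powR (powR_mulrn 2 (enorm_ge0 x)) -sqnormE; ring.
rewrite normrM (ger0_norm (powR_ge0 _ _)) -mulrA powRM//; last first.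
  by rewrite mulr_ge0 ?powR_ge0 ?enorm_ge0.
rewrite -mulrA; congr (_ * _).
have -> : enorm x `^ (2 * b - 2) * enorm x = enorm x `^ (2 * b - 2 + 1).
  by rewrite [RHS]powRD ?Xn0 ?implybT// powRr1 ?enorm_ge0.
rewrite -powRrM -powRN -powRD ?Xn0 ?implybT//.
by congr (_ `^ _); rewrite b2 /k /s; field; rewrite gt_eqF.
Qed.

Lemma lhs_radial_ge (x : 'rV[R]_d) : Omega R d x ->
  shell_density (2 * t) r x <= `|radial_test x| `^ p / enorm x `^ s.
Proof.
move=> xO; rewrite /shell_density indicE.
case: (boolP (x \in shell _ _)) => [/set_mem[_ /= /andP[xt xr]]|_]; last first.
  by rewrite mul0r mulr_ge0 ?invr_ge0 ?powR_ge0.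
have X0 : 0 < enorm x by apply: lt_le_trans xt; rewrite mulr_gt0.
rewrite lhs_radial// mul1r.
have [|c1 _] := cutoff_plateau al0 albe (z := sqnorm x).
  rewrite sqnormE (_ : 4 * al = (2 * t) ^+ 2); last by rewrite /al; ring.
  by rewrite /be !lerXn2r ?nnegrE ?mulr_ge0 ?enorm_ge0// ?(ltW r0) ?(ltW t0) ?(ltW xr).
by rewrite /chi c1 powR1 mul1r.
Qed.

Let densE (l m : R) (x : 'rV[R]_d) : Omega R d x -> l <= enorm x < m ->
  shell_density l m x = enorm x `^ (- d%:R).
Proof.
by move=> xO xlm; rewrite /shell_density indicE mem_set ?mul1r//; split.
Qed.

Lemma lhs_radial_le (x : 'rV[R]_d) : Omega R d x ->
  `|radial_test x| `^ p / enorm x `^ s <= shell_density t (2 * r) x.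
Proof.
move=> xO; have u0 : radial_test x = 0 ->
    `|radial_test x| `^ p / enorm x `^ s <= shell_density t (2 * r) x.
  by move=> ->; rewrite normr0 powR0 ?gt_eqF// mul0r shell_density_ge0.
have [xtr|/radial_test_off_shell[/u0//]] := boolP (t <= enorm x <= 2 * r).
have /andP[xt] := xtr; rewrite le_eqVlt => /predU1P[xr|xr].
  apply: u0; rewrite radial_testE// /prof /profile (cutoff_high al0 albe) ?mulr0//.
  by rewrite sqnormE xr /be (_ : 4 * r ^+ 2 = (2 * r) ^+ 2)//; ring.
have X0 : 0 < enorm x by apply: lt_le_trans xt.
rewrite lhs_radial// densE ?xt// ler_piMl ?powR_ge0//.
have /andP[c0 c1] := cutoff_itv al be (sqnorm x).
have := ge0_ler_powR (ltW p0) _ _ c1; rewrite powR1; apply; rewrite nnegrE.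
  exact: c0.
exact: ler01.
Qed.

(** On the plateau the gradient is exactly kap |x|^(-k/p-1); on the two extreme
    shells it is estimated with the bound on the derivative of the cutoff. *)
Lemma grad_radial_le (K : R) (x : 'rV[R]_d) :
  0 <= K -> (forall y, `|dstep y| <= K) -> Omega R d x ->
  enorm (gradient radial_test x) `^ p / enorm x `^ (p * a) <=
  kap `^ p * shell_density (2 * t) r x +
  (kap + 8 * K) `^ p * (shell_density t (2 * t) x + shell_density r (2 * r) x).
Proof.
move=> K0 dstep_le xO; set M := (kap + 8 * K) `^ p.
have D0 l m : 0 <= shell_density l m x by exact: shell_density_ge0.
have M0 : 0 <= M by exact: powR_ge0.
have kp0 : 0 <= kap `^ p by exact: powR_ge0.
have kD0 : 0 <= kap `^ p * shell_density (2 * t) r x := mulr_ge0 kp0 (D0 _ _).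
have MD0 : 0 <= M * (shell_density t (2 * t) x + shell_density r (2 * r) x) :=
  mulr_ge0 M0 (addr_ge0 (D0 _ _) (D0 _ _)).
have rhs0 : 0 <= kap `^ p * shell_density (2 * t) r x +
    M * (shell_density t (2 * t) x + shell_density r (2 * r) x).
  exact: (addr_ge0 kD0 MD0).
have [/andP[xt xr]|/radial_test_off_shell[_ ->]] := boolP (t <= enorm x <= 2 * r); last first.
  by rewrite enorm0 powR0 ?gt_eqF// mul0r; exact: rhs0.
have X0 : 0 < enorm x by apply: lt_le_trans xt.
rewrite grad_radial//.
set z := sqnorm x.
have z0 : 0 <= z by rewrite /z sqnormE sqr_ge0.
have [c0 c1] := andP (cutoff_itv al be z).
have kap0 : 0 <= kap by rewrite divr_ge0// ltW.
have nb : `|2 * b| = kap by rewrite b2 normrN normrM normfV (gtr0_norm p0).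
have bound : `|2 * b * chi z + 2 * (z * chi' z)| `^ p <= M.
  have K8 : 0 <= kap + 8 * K by rewrite addr_ge0// mulr_ge0.
  apply: (ge0_ler_powR (ltW p0)); rewrite ?nnegrE//.
  rewrite (le_trans (ler_normD _ _))// lerD//.
    by rewrite normrM nb (ger0_norm c0) ler_piMr.
  rewrite normrM ger0_norm// [8 * K](_ : _ = 2 * (4 * K)); last by ring.
  by rewrite ler_wpM2l//; exact: (cutoff'_le al0 albe K0 dstep_le).
have Xd0 : 0 <= enorm x `^ (- d%:R) by exact: powR_ge0.
have edge l m : l <= enorm x < m ->
    `|2 * b * chi z + 2 * (z * chi' z)| `^ p * enorm x `^ (- d%:R) <=
    M * shell_density l m x.
  by move=> xlm; rewrite densE// ler_wpM2r.
have [x2t|x2t] := ltP (enorm x) (2 * t).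
  apply: (le_trans (edge t (2 * t) _)); first by rewrite xt.
  by rewrite (ler_wpDl kD0)// ler_wpM2l// lerDl.
have [xr'|xr'] := ltP (enorm x) r.
  apply: (ler_wpDr MD0); rewrite densE ?x2t//.
  have [|e1 e2] := cutoff_plateau al0 albe (z := z).
    rewrite /z sqnormE (_ : 4 * al = (2 * t) ^+ 2); last by rewrite /al; ring.
    by rewrite /be !lerXn2r ?nnegrE ?mulr_ge0 ?enorm_ge0// ?(ltW r0) ?(ltW t0) ?(ltW xr').
  by rewrite /chi e1 /chi' e2 !mulr0 addr0 mulr1 nb.
move: xr; rewrite le_eqVlt => /predU1P[xr|xr].
  have zb : 4 * be <= z by rewrite /z sqnormE xr /be (_ : 4 * r ^+ 2 = (2 * r) ^+ 2)//; ring.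
  rewrite /chi (cutoff_high al0 albe zb) /chi' (cutoff'_high al0 albe zb).
  by rewrite !mulr0 addr0 normr0 powR0 ?gt_eqF// mul0r.
apply: (le_trans (edge r (2 * r) _)); first by rewrite xr'.
by rewrite (ler_wpDl kD0)// ler_wpM2l// lerDr.
Qed.

End testfun.

(** * Optimality of the constant *)

Section optimal.
Context (R : realType) (d : nat) (p c a : R) (A : 'M[R]_d).
Hypotheses (d1 : (1 <= d)%N) (p1 : 1 < p) (c0 : 0 < c) (Apsd : pos_semidef A).

Lemma le_integral_Omega (f g : borel_rV R d -> R) :
  measurable_fun setT f -> measurable_fun setT g ->
  (forall x, 0 <= f x) -> (forall x, Omega R d x -> f x <= g x) ->
  (\int[lebesgue_rV R d]_(x in Omega R d) (f x)%:E <=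
   \int[lebesgue_rV R d]_(x in Omega R d) (g x)%:E)%E.
Proof.
move=> mf mg f0 fg; have mO := @measurable_Omega R d.
apply: ge0_le_integral => //.
- by move=> x _; rewrite lee_fin.
- by apply/measurable_EFinP/measurable_funTS.
- by apply/measurable_EFinP/measurable_funTS.
Qed.

Lemma shell_density_off l m (x : borel_rV R d) : ~ Omega R d x ->
  shell_density l m x = 0.
Proof.
by move=> xO; rewrite /shell_density indicE memNset ?mul0r// => -[].
Qed.

Lemma rho_le x : rho p c A x <= c.
Proof.
rewrite /rho ler_piMr ?(ltW c0)// -[leRHS]expR0 ler_expR oppr_le0.
by rewrite mulr_ge0 ?powR_ge0// invr_ge0 ltW// (lt_trans _ p1).
Qed.

(** From e^y >= 1 + y. *)
Lemma rho_ge del x : quad_form A x `^ (p / 2) <= del -> c * (1 - del / p) <= rho p c A x.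
Proof.
move=> xdel; have p0 : 0 < p by exact: lt_trans p1.
rewrite /rho ler_pM2l// (le_trans _ (expR_ge1Dx _))// lerD2l lerN2 mulrC.
by rewrite ler_pM2r ?invr_gt0.
Qed.

Lemma hardy_optimal (lam : R) : (`|d%:R - p * (a + 1)| / p) `^ p < lam ->
  ~ (forall u : 'rV[R]_d -> R, Cc_infty0 u -> hardy_inequality p a A c0 lam u).
Proof.
set k := d%:R - p * (a + 1); set kap := `|k| / p => lamk H.
have p0 : 0 < p by exact: lt_trans p1.
have kp0 : 0 <= kap `^ p by exact: powR_ge0.
pose kap1 := kap `^ (p - 1).
have k10 : 0 <= kap1 by exact: powR_ge0.
have lam0 : 0 < lam by exact: le_lt_trans lamk.
have [K K0 stK] := @dstep_bounded R.
have [C C0 HC] := quad_form_le A.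
pose eps := lam - kap `^ p.
have eps0 : 0 < eps by rewrite subr_gt0.
(* del is chosen so that lam (1 - del / p) > kap^p + kap1 del. *)
pose q := lam / p + kap1.
have q0 : 0 <= q by rewrite addr_ge0// divr_ge0// ltW.
pose del := eps / (q + 1).
have del0 : 0 < del by rewrite divr_gt0// ltr_wpDl.
have delq : del * q < eps.
  by rewrite /del mulrAC ltr_pdivrMr ?ltr_wpDl// ltr_pM2l// ltrDl.
(* The test functions live in |x| <= 2 r, and there x^t A x <= 4 C r^2. *)
pose r := Num.sqrt (del `^ (2 / p) / (4 * C)).
have C4 : 0 < 4 * C by rewrite mulr_gt0.
have r0 : 0 < r by rewrite sqrtr_gt0 divr_gt0// powR_gt0.
have rdel : (4 * C * r ^+ 2) `^ (p / 2) = del.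
  rewrite sqr_sqrtr ?divr_ge0 ?powR_ge0 ?(ltW C4)// mulrCA divff ?gt_eqF// mulr1.
  rewrite -powRrM (_ : 2 / p * (p / 2) = 1) ?powRr1 ?(ltW del0)//.
  by field; rewrite gt_eqF.
pose M := (kap + 8 * K) `^ p.
have M0 : 0 <= M by exact: powR_ge0.
(* The gain per shell; n shells must outweigh the contribution y eps' of the
   two extreme shells. *)
pose eps' := eps - del * q.
have eps'0 : 0 < eps' by rewrite subr_gt0.
pose y := (2 * M + 2 * kap1 * del) / eps'.
have y0 : 0 <= y.
  apply: divr_ge0; last exact: ltW.
  apply: addr_ge0; first by apply: mulr_ge0.
  exact: (mulr_ge0 (mulr_ge0 (ler0n _ 2) k10) (ltW del0)).
have [n yn] : exists n, y < n%:R by exists (Num.bound y); exact: archi_boundP.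
pose t := r / 2 ^+ n.+1.
have t0 : 0 < t by rewrite divr_gt0// exprn_gt0.
have t2 : 2 * t = r / 2 ^+ n by rewrite /t exprS; field; rewrite expf_neq0.
have tr : 2 * t <= r.
  by rewrite t2 ler_pdivrMr ?exprn_gt0// ler_peMr ?(ltW r0)// exprn_ege1// ler1n.
pose u := radial_test p a d1 t r.
have Cu : Cc_infty0 u by exact: Cc_radial_test.
have [smu _ _] := Cu.
have cu : continuous u by have [] := smu [::].
have cdu i : continuous (partial i u) by have [] := smu [:: i].
have := H u Cu; rewrite hardy_inequalityE// -/k -/kap -/kap1.
have cdel0 : 0 <= c * (1 - del / p).
  have e1 : 0 < lam * (1 - del / p).
    have -> : lam * (1 - del / p) = eps' + kap `^ p + kap1 * del.
      by rewrite /eps' /eps /q; field; rewrite gt_eqF.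
    by apply: ltr_wpDr; [exact: (mulr_ge0 k10 (ltW del0))|exact: ltr_wpDr].
  by rewrite mulr_ge0 ?(ltW c0)// -(pmulr_rge0 _ lam0) ltW.
have mD l m := @measurable_shell_density R d l m.
have D0 l m := @shell_density_ge0 R d l m.
have Q_hi x : enorm x <= 2 * r -> quad_form A x `^ (p / 2) <= del.
  move=> xr; rewrite -rdel; apply: ge0_ler_powR; rewrite ?nnegrE//.
  - by rewrite divr_ge0// ltW.
  - by rewrite mulr_ge0 ?sqr_ge0// ltW.
  rewrite (le_trans (HC x))// [leRHS](_ : _ = C * (2 * r) ^+ 2); last by ring.
  rewrite ler_pM2l// lerXn2r ?nnegrE ?enorm_ge0//.
  by rewrite mulr_ge0// ltW.
have rho_lo x : enorm x <= 2 * r -> c * (1 - del / p) <= rho p c A x.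
  by move=> xr; apply: rho_ge; exact: Q_hi.
have [w w0 wE] : exists2 w : R, 0 < w & @shell_mass R d 1 2 = w%:E.
  have w0 := @shell_mass_gt0 R d d1; have wf := @shell_mass_lty R d 1 2 ltr01.
  exists (fine (@shell_mass R d 1 2)); first by rewrite fine_gt0// w0 wf.
  by rewrite fineK// ge0_fin_numE// ltW.
have m_mid : @shell_mass R d (2 * t) r = (n%:R * w)%:E.
  by rewrite t2 shell_mass_dyadic// wE -EFinM.
have m_low : @shell_mass R d t (2 * t) = w%:E.
  by rewrite -{1}(mulr1 t) [2 * t]mulrC shell_massZ.
have m_high : @shell_mass R d r (2 * r) = w%:E.
  by rewrite -{1}(mulr1 r) [2 * r]mulrC shell_massZ.
have m_all : @shell_mass R d t (2 * r) = ((n%:R + 2) * w)%:E.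
  rewrite (@shell_mass_split _ _ _ (2 * t)); last 2 first.
  - by rewrite ler_peMl ?ler1n// ltW.
  - by rewrite (le_trans tr)// ler_peMl ?ler1n// ltW.
  rewrite (@shell_mass_split _ _ (2 * t) r)//; last by rewrite ler_peMl ?ler1n// ltW.
  by rewrite m_low m_mid m_high -!EFinD; congr EFin; ring.
have L_lo : (((c * (1 - del / p)) * (n%:R * w))%:E <=
    \int[lebesgue_rV R d]_(x in Omega R d) (hardy_lhs p c a A u x)%:E)%E.
  rewrite EFinM -m_mid /shell_mass -(ge0_integralZ_EFin _ cdel0 (mD _ _) (D0 _ _)).
  rewrite -integral_Omega_T; last by move=> x xO; rewrite shell_density_off// mulr0.
  apply: le_integral_Omega.
  - by apply: measurable_funM; [exact: measurable_cst|exact: mD].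
  - exact: measurable_hardy_lhs.
  - by move=> x; exact: (mulr_ge0 cdel0 (D0 _ _ _)).
  - move=> x xO; rewrite /hardy_lhs mulrC.
    have [xr|xr] := leP (enorm (x : 'rV[R]_d)) (2 * r); last first.
      rewrite [X in X * _](_ : _ = 0) ?mul0r.
        by rewrite !mulr_ge0 ?invr_ge0 ?powR_ge0 ?expR_ge0// ltW.
      rewrite /shell_density indicE memNset ?mul0r// => -[_ /= /andP[_ xr2]].
      have r2 : r <= 2 * r by rewrite ler_peMl ?ler1n// ltW.
      by move: (lt_trans xr (lt_le_trans xr2 r2)); rewrite ltxx.
    apply: (ler_pM (D0 _ _ _) cdel0); last exact: rho_lo.
    exact: lhs_radial_ge.
have G_hi : (\int[lebesgue_rV R d]_(x in Omega R d) (hardy_grad p c a A u x)%:E <=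
    (c * (kap `^ p * (n%:R * w) + M * (2 * w)))%:E)%E.
  (* The sum over the two extreme shells. *)
  pose rims (x : borel_rV R d) :=
    1 * shell_density t (2 * t) x + 1 * shell_density r (2 * r) x.
  have mrims : measurable_fun setT rims.
    by apply: measurable_funD; apply: measurable_funM; (exact: mD || exact: measurable_cst).
  have rims0 x : 0 <= rims x by rewrite /rims !mul1r; exact: (addr_ge0 (D0 _ _ _)).
  have ckp0 : 0 <= c * kap `^ p by exact: (mulr_ge0 (ltW c0)).
  have cM0 : 0 <= c * M by exact: (mulr_ge0 (ltW c0)).
  have -> : (c * (kap `^ p * (n%:R * w) + M * (2 * w)))%:E =
      (\int[lebesgue_rV R d]_(x in Omega R d)
        ((c * kap `^ p) * shell_density (2 * t) r x + (c * M) * rims x)%:E)%E.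
    rewrite integral_Omega_T; last first.
      by move=> x xO; rewrite /rims !shell_density_off// !mulr0 addr0 mulr0 addr0.
    rewrite (ge0_integral_lincomb _ ckp0 cM0 (mD _ _) mrims (D0 _ _) rims0).
    rewrite (ge0_integral_lincomb _ ler01 ler01 (mD _ _) (mD _ _) (D0 _ _) (D0 _ _)).
    have i_mid : (\int[lebesgue_rV R d]_x (shell_density (2 * t) r x)%:E =
      (n%:R * w)%:E)%E := m_mid.
    have i_low : (\int[lebesgue_rV R d]_x (shell_density t (2 * t) x)%:E = w%:E)%E
      := m_low.
    have i_high : (\int[lebesgue_rV R d]_x (shell_density r (2 * r) x)%:E = w%:E)%E
      := m_high.
    rewrite i_mid i_low i_high !mul1e -[RHS]EFinD.
    by congr EFin; ring.
  apply: le_integral_Omega.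
  - exact: measurable_hardy_grad.
  - apply: measurable_funD; apply: measurable_funM; try exact: measurable_cst.
      exact: mD.
    exact: mrims.
  - exact: (hardy_grad_ge0 p a A c0 u).
  - move=> x xO; rewrite /hardy_grad /rims !mul1r -!(mulrA c) -mulrDr mulrC.
    apply: ler_pM; [exact: (rho_ge0 p A c0)| |exact: rho_le|].
      by apply: mulr_ge0; rewrite ?invr_ge0 powR_ge0.
    exact: (grad_radial_le a d1 p1 t0 tr K0 stK xO).
have Q_int_hi : (\int[lebesgue_rV R d]_(x in Omega R d) (hardy_quad p c a A u x)%:E <=
    (del * c * ((n%:R + 2) * w))%:E)%E.
  have dc0 : 0 <= del * c by exact: (mulr_ge0 (ltW del0) (ltW c0)).
  rewrite EFinM -m_all /shell_mass -(ge0_integralZ_EFin _ dc0 (mD _ _) (D0 _ _)).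
  rewrite -integral_Omega_T; last by move=> x xO; rewrite shell_density_off// mulr0.
  apply: le_integral_Omega.
  - exact: measurable_hardy_quad.
  - by apply: measurable_funM; [exact: measurable_cst|exact: mD].
  - exact: (hardy_quad_ge0 p a A c0 u).
  - move=> x xO; rewrite hardy_quadE.
    have I_le := lhs_radial_le a d1 p1 t0 tr xO.
    have I0 : 0 <= `|u x| `^ p / enorm (x : 'rV[R]_d) `^ (p * (a + 1)).
      by apply: mulr_ge0; rewrite ?invr_ge0 powR_ge0.
    have [xr|xr] := leP (enorm (x : 'rV[R]_d)) (2 * r); last first.
      have D_0 : shell_density t (2 * r) x = 0.
        rewrite /shell_density indicE memNset ?mul0r// => -[_ /= /andP[_ xr2]].
        by move: (lt_trans xr xr2); rewrite ltxx.
      rewrite D_0 mulr0; rewrite D_0 in I_le.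
      have -> : hardy_lhs p c a A u x = 0.
        by rewrite /hardy_lhs (le_anti (introT andP (conj I_le I0))) mul0r.
      by rewrite mulr0.
    rewrite -mulrA; apply: ler_pM; [exact: powR_ge0| |exact: Q_hi|].
      exact: (hardy_lhs_ge0 p a A c0 u x).
    rewrite /hardy_lhs mulrC.
    by apply: ler_pM; [exact: (rho_ge0 p A c0)|exact: I0|exact: rho_le|exact: I_le].
move: L_lo G_hi Q_int_hi.
set IL := (\int[lebesgue_rV R d]_(x in Omega R d) (hardy_lhs p c a A u x)%:E)%E.
set IG := (\int[lebesgue_rV R d]_(x in Omega R d) (hardy_grad p c a A u x)%:E)%E.
set IQ := (\int[lebesgue_rV R d]_(x in Omega R d) (hardy_quad p c a A u x)%:E)%E.
have IQ0 : (0 <= IQ)%E.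
  by apply: integral_ge0 => x _; rewrite lee_fin; exact: (hardy_quad_ge0 p a A c0 u).
move: IL IG IQ IQ0 => IL IG IQ IQ0 L_lo G_hi Q_int_hi HH.
have : (lam%:E * ((c * (1 - del / p)) * (n%:R * w))%:E <=
    (c * (kap `^ p * (n%:R * w) + M * (2 * w)))%:E +
    kap1%:E * (del * c * ((n%:R + 2) * w))%:E)%E.
  apply: (le_trans (lee_wpmul2l _ L_lo)); first by rewrite lee_fin ltW.
  apply: (le_trans HH); apply: leeD => //.
  apply: (@le_trans _ _ (kap1%:E * IQ)%E); last by apply: lee_wpmul2l => //; rewrite lee_fin.
  apply: lee_wpmul2r => //; rewrite lee_fin ler_piMr//.
  by case: (sgrP k); rewrite ?ler01// lerN10.
rewrite -!EFinM -EFinD lee_fin; apply/negP; rewrite -ltNge.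
have yE : 2 * M + 2 * kap1 * del < n%:R * eps'.
  by rewrite -ltr_pdivrMr.
rewrite -subr_gt0 [ltRHS](_ : _ = c * w * (n%:R * eps' - (2 * M + 2 * kap1 * del))).
  by rewrite mulr_gt0 ?mulr_gt0// subr_gt0.
by rewrite /eps' /eps /q; field; rewrite gt_eqF.
Qed.

End optimal.

Theorem theorem3p1 (R : realType) (d : nat) (hd : (1 <= d)%N)
    (p : R) (hp : 1 < p) (c : R) (hc : 0 < c)
    (A : 'M[R]_d) (Asym : A^T = A) (Apsd : pos_semidef A) (a : R) :
  (forall u : 'rV[R]_d -> R, Cc_infty0 u ->
     hardy_inequality p a A hc ((`|d%:R - p * (a + 1)| / p) `^ p) u) /\
  (A = 0 \/ pos_def A ->
   forall lam : R, (`|d%:R - p * (a + 1)| / p) `^ p < lam ->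
     ~ (forall u : 'rV[R]_d -> R, Cc_infty0 u ->
          hardy_inequality p a A hc lam u)).
Proof.
split=> [u|_ lam]; first exact: weighted_hardy.
exact: hardy_optimal.
Qed.
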